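(* Let $\{W(t),t\in\mathbb{R}\}$ be one-dimensional standard Brownian motion, $b>0$, $k\in\mathbb{N}$, and let $Z$, $Z^{(k)}$, $X_k$, $C_k$ be as defined in the context. Let $x(k)<c(k)<0$ be real numbers. Then $$\mathbb{P}\big(Z^{(k)}(t)\neq Z(t)\text{ for some }t\in[-b,b]\ \big|\ X_k\leq x(k),\,C_k>c(k)\big)\leq 4e^{-c(k)}\frac{b}{c(k)-x(k)}\exp\left(\frac b2\right)\left(1-\Phi\left(\frac{c(k)-x(k)-b}{\sqrt b}\right)\right).\qquad(\mathrm{i})$$ Furthermore, $$\mathbb{P}(C_k\leq c(k))\leq 1-\left(1-\exp\left(-\exp\left(-\frac{c(k)}2\right)\right)\right)\cdot\left(2\Phi\left(-\frac{c(k)}{2\sqrt b}\right)-1\right)^2\qquad(\mathrm{ii})$$ and $$\mathbb{P}(X_k>x(k))\leq\frac{\exp(-(k-1)x(k))}{(k-1)!}\left(1-\exp(-\exp(-x(k)))\right).\qquad(\mathrm{iii})$$ The unconditional error probability $\mathbb{P}(Z^{(k)}(t)\neq Z(t)\text{ for some }t\in[-b,b])$ is bounded by the sum of the right-hand sides of (i), (ii) and (iii).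
   Context: $\Phi$ is the standard normal distribution function. Standard Brownian motion on $\mathbb{R}$ is two-sided with $W(0)=0$ and $\sigma^2(t)=\mathrm{Var}(W(t))=|t|$. Let $Y_i$, $i\in\mathbb{N}$, be i.i.d. standard exponential random variables and $X_k:=\log\big(1/\sum_{i=1}^kY_i\big)$, so that $\sum_i\delta_{X_i}$ is a Poisson point process on $\mathbb{R}$ with intensity measure $e^{-x}dx$ and $X_1>X_2>\cdots$. Let $W_i(\cdot)$, $i\in\mathbb{N}$, be independent copies of $W$, independent of the $Y_i$. Define $$Z(t)=\max_{i\in\mathbb{N}}\left(X_i+W_i(t)-\tfrac{|t|}{2}\right),\qquad Z^{(k)}(t)=\max_{i=1,\ldots,k}\left(X_i+W_i(t)-\tfrac{|t|}2\right),\qquad C_k:=\inf_{t\in[-b,b]}\left(Z^{(k)}(t)+\tfrac{|t|}2\right).$$ *)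

(* Defs.v *)
From HB Require Import structures.
From mathcomp Require Import all_boot all_order all_algebra.
From mathcomp Require Import finmap.
From mathcomp Require Import all_classical all_reals all_analysis.

Set Implicit Arguments.
Unset Strict Implicit.
Unset Printing Implicit Defensive.

Import Order.TTheory GRing.Theory Num.Theory.
Import numFieldNormedType.Exports.

Local Open Scope classical_set_scope.
Local Open Scope ring_scope.

Section independence.
Context d (T : measurableType d) (R : realType) (P : probability T R).

Definition sigma_rv (X : T -> R) : set_system T :=
  preimage_set_system setT X measurable.

Definition sigma_process (I : Type) (X : I -> T -> R) : set_system T :=
  <<s \bigcup_i sigma_rv (X i) >>.

Definition mutually_independent (I : choiceType) (F : I -> set_system T) :=
  forall (J : {fset I}) (A : I -> set T), (forall i, i \in J -> F i (A i)) ->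
    P (\bigcap_(i in [set` J]) A i) = (\prod_(i <- J) P (A i))%E.

Definition independent2 (F G : set_system T) :=
  forall A B, F A -> G B -> P (A `&` B) = (P A * P B)%E.

(* P(A | B); equal to 0 when P(B) = 0, by the convention x / 0 = 0. *)
Definition cond_prob (A B : set T) : R := fine (P (A `&` B)) / fine (P B).

End independence.

Definition Phi (R : realType) (x : R) : R :=
  fine (normal_prob (0 : R) 1 `]-oo, x]).

(* Since the parameter t ranges over all reals and t_0 < ... < t_n may straddle
   0, this is two-sided Brownian motion, with Var(W(t)) = |t|.  The second
   argument of [normal_prob] is the standard deviation. *)
Record standard_brownian_motion d (T : measurableType d) (R : realType)
    (P : probability T R) (W : R -> {RV P >-> R}) : Prop := {
  sbm_start : forall w, W 0 w = 0 ;
  sbm_continuous : forall w, continuous (fun t : R => W t w) ;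
  sbm_increments : forall s t : R, s < t ->
    forall A : set R, measurable A ->
    P ((fun w => W t w - W s w) @^-1` A) = normal_prob 0 (Num.sqrt (t - s)) A ;
  sbm_independent : forall (n : nat) (t : nat -> R),
    (forall i, (i < n)%N -> t i < t i.+1) ->
    mutually_independent P
      (fun i : 'I_n => sigma_rv (fun w => W (t i.+1) w - W (t i) w)) }.

(* Y i and W i (i = 0, 1, ...) stand for the Y_{i+1} and W_{i+1} of a family indexed
   from 1. *)
Section brown_resnick.
Context d (T : measurableType d) (R : realType) (P : probability T R).
Variables (Y : nat -> {RV P >-> R}) (W : nat -> R -> {RV P >-> R}).

Record brown_resnick_input : Prop := {
  Y_exponential : forall (i : nat) (A : set R), measurable A ->
    distribution P (Y i) A = exponential_prob 1 A ;
  Y_independent : mutually_independent P (fun i => sigma_rv (Y i)) ;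
  W_brownian : forall i, standard_brownian_motion (W i) ;
  W_independent : mutually_independent P
    (fun i => sigma_process (fun (t : R) (w : T) => W i t w)) ;
  YW_independent : independent2 P
    (sigma_process (fun (i : nat) (w : T) => Y i w))
    (sigma_process (fun (it : nat * R) (w : T) => W it.1 it.2 w)) }.

(* X_k = log (1 / (Y_1 + ... + Y_k)); only meaningful for k >= 1. *)
Definition log_arrival (k : nat) (w : T) : R := ln (1 / \sum_(i < k) Y i w).

Definition BR_path (i : nat) (t : R) (w : T) : R :=
  log_arrival i.+1 w + W i t w - `|t| / 2.

(* Z(t); the maximum over all i is taken in the extended reals, since it is attained
   only almost surely. *)
Definition Z_all (t : R) (w : T) : \bar R :=
  ereal_sup (range (fun i : nat => (BR_path i t w)%:E)).

(* Z^(k)(t), the maximum of the first k paths, for k >= 1: starting the iteration from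
   [BR_path 0 t w], which is one of them, adds nothing. *)
Definition Z_first (k : nat) (t : R) (w : T) : R :=
  \big[Num.max/BR_path 0 t w]_(i < k) BR_path i t w.

(* C_k = inf_{|t| <= b} (Z^(k)(t) + |t|/2). *)
Definition inf_first (b : R) (k : nat) (w : T) : R :=
  inf [set Z_first k t w + `|t| / 2 | t in `[- b, b]].

Definition Z_error (b : R) (k : nat) : set T :=
  [set w | exists2 t, t \in `[- b, b] & (Z_first k t w)%:E <> Z_all t w].

End brown_resnick.

Definition bound_cond_error (R : realType) (b x c : R) : R :=
  4 * expR (- c) * (b / (c - x)) * expR (b / 2)
    * (1 - Phi ((c - x - b) / Num.sqrt b)).

Definition bound_inf_first (R : realType) (b c : R) : R :=
  1 - (1 - expR (- expR (- (c / 2))))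
        * (2 * Phi (- (c / (2 * Num.sqrt b))) - 1) ^+ 2.

Definition bound_log_arrival (R : realType) (k : nat) (x : R) : R :=
  expR (- (k.-1%:R * x)) / (k.-1)`!%:R * (1 - expR (- expR (- x))).

(* Main.v *)
Require Import Defs.
From HB Require Import structures.
From mathcomp Require Import all_boot all_order all_algebra.
From mathcomp Require Import finmap.
From mathcomp Require Import all_classical all_reals all_analysis.
From mathcomp Require Import measurable_realfun.
From mathcomp Require Import ring lra.

Set Implicit Arguments.
Unset Strict Implicit.
Unset Printing Implicit Defensive.

Import Order.TTheory GRing.Theory Num.Theory.
Import numFieldNormedType.Exports.

Local Open Scope classical_set_scope.
Local Open Scope ring_scope.

(** Let [S_i] be the sum of the first [i] exponential variables, so that the
    [i]-th arrival is [X_i = - ln S_i]; variables and paths are numbered from 0,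
    arrivals from 1.

    The conditional error probability.  Suppose that [X_k <= x], that [C_k > c],
    and that path [k + j] rises above the maximum of the first [k] paths at some
    time in [[- b, b]].  Then its Brownian part exceeds [c - X] there, with [X]
    its arrival.  As [S_k >= expR (- x)], the supremum [M] of that Brownian
    motion exceeds the barrier [c + ln (expR (- x) + S')], where [S'] is the sum
    of the exponential variables of index [k], ..., [k + j] ([Z_error_hit]).
    This event is independent of the first [k] arrivals and paths
    ([good_event_indep]), so it remains to sum its probability over [j].  Levy's
    inequality on both halves of the interval gives
    [P (M > r) <= 4 * (1 - Phi (r / sqrt b))] ([brownian_sup_tail]), and Mills'
    ratio bounds this, for [r] the barrier, by a function [h] of [S'], a multiple
    of a Gaussian density at the barrier ([hit_density]).  For varying [j] the
    sums [S'] are the points of a unit rate Poisson process, so the expected sum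
    of [h] is its integral over the half-line, which is the asserted bound.  The
    proof reaches this value through a supermartingale: the tail integral [G] of
    [h] is an explicit multiple of a normal tail ([hit_potential]), and
    [G' = - h] implies that the mean of [h + G] after one exponential step from
    [u] is [G u] ([exp_shift_hit], [renewal_bound]).

    The infimum.  [C_k > c] holds as soon as the first arrival exceeds [c / 2]
    and the first Brownian motion stays at or above [c / 2] on [[- b, b]].  These
    events are independent, the first is an exponential probability, and the
    second factors over the two halves of the interval, where Levy's inequality
    applies ([two_sides_exceed], [inf_first_tail]).

    The arrival.  [X_k > x] means [S_k < l] with [l = expR (- x)].  This forces
    the sum of the first [k - 1] variables and the last variable to be below
    [l], and the former has probability at most the volume of a simplex,
    [l ^+ (k - 1)] over the factorial of [k - 1] ([prob_block_sumS_lt]).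

    The unconditional bound splits the error event according to the two
    conditions. *)

(** * Independence of generated sigma-algebras *)

Section independence_lemmas.
Context d (T : measurableType d) (R : realType) (P : probability T R).
Implicit Types G : set_system T.

Lemma independent2_sym G1 G2 : independent2 P G1 G2 -> independent2 P G2 G1.
Proof. by move=> h A B GA GB; rewrite setIC muleC; exact: h. Qed.

(** With the second event fixed, both sides of the product rule are finite
    measures in the first one; measures that agree on a pi-system agree on the
    sigma-algebra it generates. *)
Lemma independent2_generate_l G1 G2 :
  G1 `<=` measurable -> G2 `<=` measurable -> setI_closed G1 -> G1 setT ->
  independent2 P G1 G2 -> independent2 P <<s G1 >> G2.
Proof.
move=> m1 m2 G1I G1T G12 A B sA GB.
have mB := m2 _ GB.
have fB : (0 <= fine (P B))%R by rewrite fine_ge0.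
have PBE : P B = (fine (P B))%:E by rewrite fineK// fin_num_measure.
pose nu1 := mrestr P mB.
pose nu2 := mscale (NngNum fB) P.
suff : nu1 A = nu2 A by rewrite /nu1 /nu2 /= /mscale /mrestr/= -PBE muleC.
apply: (g_sigma_algebra_measure_unique G1 m1 (fun=> setT)) => //.
- by rewrite bigcup_const.
- by move=> C GC; rewrite /nu1 /nu2 /= /mscale/= /mrestr -PBE muleC; exact: G12.
- by move=> _; rewrite /nu1 /= /mrestr setTI ltey_eq fin_num_measure.
Qed.

Lemma sub_generate_measurable G : G `<=` measurable -> <<s G >> `<=` measurable.
Proof. by move=> h; apply: smallest_sub => //; exact: sigma_algebra_measurable. Qed.

Lemma independent2_generate G1 G2 :
  G1 `<=` measurable -> G2 `<=` measurable ->
  setI_closed G1 -> setI_closed G2 -> G1 setT -> G2 setT ->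
  independent2 P G1 G2 -> independent2 P <<s G1 >> <<s G2 >>.
Proof.
move=> m1 m2 G1I G2I G1T G2T G12.
apply: independent2_generate_l => //; first exact: sub_generate_measurable.
apply: independent2_sym; apply: independent2_generate_l => //.
exact: independent2_sym.
Qed.

Lemma independent2W G1 G2 H1 H2 : H1 `<=` G1 -> H2 `<=` G2 ->
  independent2 P G1 G2 -> independent2 P H1 H2.
Proof. by move=> s1 s2 h A B /s1 GA /s2 GB; exact: h. Qed.

End independence_lemmas.

Section independent_blocks.
Context d (T : measurableType d) (R : realType) (P : probability T R).
Variables (I : choiceType) (F : I -> set_system T).
Hypothesis Fmeas : forall i, F i `<=` measurable.
Hypothesis FI : forall i, setI_closed (F i).
Hypothesis FT : forall i, F i setT.
Hypothesis Findep : mutually_independent P F.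

(** The pi-system behind the sigma-algebra of a block of components.  The
    family [B] is total, with [B i] in [F i] also outside of [K], so that two
    cylinders over different [K] can be intersected index by index. *)
Definition cylinders (J : set I) : set_system T := [set A |
  exists K : {fset I}, exists B : I -> set T,
    [/\ [set` K] `<=` J, forall i, F i (B i) &
        A = (\bigcap_(i in [set` K]) B i)]].

Lemma cylinders_measurable J : cylinders J `<=` measurable.
Proof.
move=> _ [K [B [_ FB ->]]]; apply: fin_bigcap_measurable => //.
by move=> i _; apply: Fmeas; exact: FB.
Qed.

Lemma cylindersT J : cylinders J setT.
Proof.
exists fset0%fset, (fun=> setT); split => //.
by apply/esym/seteqP; split.
Qed.

Lemma sub_cylinders J : \bigcup_(i in J) F i `<=` cylinders J.
Proof.
move=> A [i Ji FA].
exists [fset i]%fset, (fun j => if j == i then A else setT); split.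
- by move=> j /=; rewrite inE => /eqP ->.
- by move=> j; case: eqP => [->|].
- by rewrite set_fset1 bigcap_set1 eqxx.
Qed.

Lemma cylinders_setI J : setI_closed (cylinders J).
Proof.
move=> _ _ [K1 [B1 [K1J FB1 ->]]] [K2 [B2 [K2J FB2 ->]]].
pose C (K : {fset I}) (B : I -> set T) i := if i \in K then B i else setT.
have CE (K : {fset I}) (B : I -> set T) (L : {fset I}) : (K `<=` L)%fset ->
    (\bigcap_(i in [set` K]) B i = \bigcap_(i in [set` L]) C K B i).
  move=> /fsubsetP KL; apply/seteqP; split=> w Bw i /= iK.
    by rewrite /C; case: ifPn => // /Bw.
  by have := Bw i (KL _ iK); rewrite /C iK.
exists (K1 `|` K2)%fset, (fun i => C K1 B1 i `&` C K2 B2 i); split.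
- by move=> i /=; rewrite inE => /orP[/K1J|/K2J].
- by move=> i; apply: FI; rewrite /C; case: ifP.
- rewrite (CE _ _ (K1 `|` K2)%fset (fsubsetUl _ _)).
  by rewrite (CE _ _ (K1 `|` K2)%fset (fsubsetUr _ _)) bigcapI.
Qed.

(** The index sets of two cylinders over disjoint blocks are disjoint, so the
    product rule over their union is the product of the two product rules. *)
Lemma independent2_cylinders (J1 J2 : set I) : (J1 `&` J2 = set0) ->
  independent2 P (cylinders J1) (cylinders J2).
Proof.
move=> J12 _ _ [K1 [B1 [K1J FB1 ->]]] [K2 [B2 [K2J FB2 ->]]].
have K12 : [disjoint K1 & K2]%fset.
  apply/fdisjointP => i iK1; apply/negP => iK2.
  have : (J1 `&` J2) i by split; [exact: K1J|exact: K2J].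
  by rewrite J12.
pose B i := if i \in K1 then B1 i else B2 i.
have B2E : {in K2, B2 =1 B}.
  move=> i iK2; rewrite /B ifN//; apply/negP => iK1.
  by move/fdisjointP : K12 => /(_ _ iK1); rewrite iK2.
have -> : (\bigcap_(i in [set` K1]) B1 i = \bigcap_(i in [set` K1]) B i).
  by apply: eq_bigcapr => i /= iK; rewrite /B iK.
have -> : (\bigcap_(i in [set` K2]) B2 i = \bigcap_(i in [set` K2]) B i).
  by apply: eq_bigcapr => i /= iK; rewrite B2E.
rewrite -bigcap_setU.
have -> : ([set` K1] `|` [set` K2] = [set` (K1 `|` K2)%fset]).
  by apply/seteqP; split=> i /=; rewrite inE => /orP.
have FB i : F i (B i) by rewrite /B; case: ifP.
rewrite !Findep//.
rewrite (big_fsetID _ (mem K1))/=.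
congr (_ * _)%E; apply: eq_fbigl => i; rewrite !inE /=.
- by rewrite andb_orl andbb; case: (i \in K1); rewrite ?andbF ?orbF ?andbT.
- have := fdisjointP K12 i; case: (i \in K1) => /=; rewrite ?andbT// ?andbF.
  by move=> /(_ isT)/negbTE ->.
Qed.

Lemma independent2_blocks (J1 J2 : set I) : (J1 `&` J2 = set0) ->
  independent2 P <<s \bigcup_(i in J1) F i >> <<s \bigcup_(i in J2) F i >>.
Proof.
move=> J12.
apply: (@independent2W _ _ _ _ <<s cylinders J1 >> <<s cylinders J2 >>).
- by apply: sub_sigma_algebra2; exact: sub_cylinders.
- by apply: sub_sigma_algebra2; exact: sub_cylinders.
- apply: independent2_generate; [exact: cylinders_measurable..|
    exact: cylinders_setI|exact: cylinders_setI|exact: cylindersT|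
    exact: cylindersT|exact: independent2_cylinders].
Qed.

End independent_blocks.

(** * Integrals under independence and under densities *)

Section independent_integral.
Context d d1 d2 (T : measurableType d) (T1 : measurableType d1)
  (T2 : measurableType d2) (R : realType) (P : probability T R).
Local Open Scope ereal_scope.

(** Independence says that the joint law is the product of the marginals on
    rectangles, hence everywhere, and Tonelli applies.  The formula is pulled
    back to the sample space: the inner integral is over an independent copy of
    the randomness of [g]. *)
Lemma independent_fubini (f : T -> T1) (g : T -> T2)
    (mf : measurable_fun setT f) (mg : measurable_fun setT g) :
  (forall A B, measurable A -> measurable B ->
    P (f @^-1` A `&` g @^-1` B) = P (f @^-1` A) * P (g @^-1` B)) ->
  forall F : T1 * T2 -> \bar R, measurable_fun setT F -> (forall z, 0 <= F z) ->
  \int[P]_w F (f w, g w) = \int[P]_w \int[P]_v F (f w, g v).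
Proof.
move=> fg F mF F0.
pose f' : {RV P >-> T1} := HB.pack f (isMeasurableFun.Build _ _ _ _ _ mf).
pose g' : {RV P >-> T2} := HB.pack g (isMeasurableFun.Build _ _ _ _ _ mg).
have mh : measurable_fun setT (fun w => (f w, g w)).
  exact/measurable_fun_pair.
pose h' : {RV P >-> (T1 * T2)%type} :=
  HB.pack (fun w => (f w, g w)) (isMeasurableFun.Build _ _ _ _ _ mh).
have hE X : measurable X ->
    (distribution P f' \x distribution P g') X = distribution P h' X.
  apply: product_measure_unique => A B mA mB.
  by rewrite /= -fg.
transitivity (\int[distribution P h']_z F z).
  by rewrite ge0_integral_distribution.
transitivity (\int[distribution P f' \x distribution P g']_z F z).
  by apply: eq_measure_integral => A mA _; have := hE A mA; exact: esym.
rewrite (fubini_tonelli1 (m1 := distribution P f') (m2 := distribution P g'))//.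
rewrite /fubini_F ge0_integral_distribution//; last 2 first.
- exact: measurable_fun_fubini_tonelli_F.
- by move=> y; exact: integral_ge0.
apply: eq_integral => w _ /=.
rewrite ge0_integral_distribution//.
by apply: measurableT_comp => //.
Qed.

End independent_integral.

Section density.
Context (R : realType).
Local Open Scope ereal_scope.
Notation mu := (@lebesgue_measure R).
Import HBNNSimple.

(** True by assumption for indicators; simple functions and monotone limits
    give the rest. *)
Lemma ge0_integral_density (nu : {measure set R -> \bar R}) (p : R -> R) :
  measurable_fun setT p -> (forall x, (0 <= p x)%R) ->
  (forall A, measurable A -> nu A = \int[mu]_(x in A) (p x)%:E) ->
  forall f : R -> \bar R, measurable_fun setT f -> (forall x, 0 <= f x) ->
  \int[nu]_x f x = \int[mu]_x (f x * (p x)%:E).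
Proof.
move=> mp p0 nuE f mf f0.
have mpE : measurable_fun setT (EFin \o p) by exact/measurable_EFinP.
have sE (s : {nnsfun _ >-> R}) :
    \int[nu]_x (s x)%:E = \int[mu]_x ((s x)%:E * (p x)%:E).
  under [LHS]eq_integral do rewrite fimfunE -fsumEFin//.
  rewrite [LHS]ge0_integral_fsum//; last 2 first.
    - by move=> r; exact/measurable_EFinP/measurableT_comp.
    - by move=> n x _; rewrite EFinM nnfun_muleindic_ge0.
  under [RHS]eq_integral.
    move=> x xD; rewrite fimfunE -fsumEFin// ge0_mule_fsuml; last first.
      by move=> r; rewrite EFinM nnfun_muleindic_ge0.
    over.
  have mi r : measurable_fun setT
      (fun x => (r * \1_(s @^-1` [set r]) x)%:E).
    exact/measurable_EFinP/measurableT_comp.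
  rewrite [RHS]ge0_integral_fsum//; last 2 first.
  - move=> r; apply: emeasurable_funM; [exact: mi|exact: mpE].
  - move=> n x _; rewrite mule_ge0// ?lee_fin//.
    by have := nnfun_muleindic_ge0 s n x; rewrite -EFinM lee_fin.
  apply: eq_fsbigr => r /[!inE] -[x _ <-].
  under [RHS]eq_integral do rewrite EFinM -muleA.
  rewrite ge0_integralZl//; last 3 first.
  - have mI : measurable_fun setT (fun y => (\1_(s @^-1` [set s x]) y : R)%:E).
      exact/measurable_EFinP/measurable_indic.
    by apply: emeasurable_funM; [exact: mI|exact: mpE].
  - by move=> y _; rewrite mule_ge0// lee_fin.
  - by rewrite lee_fin.
  rewrite integralZl_indic_nnsfun//= integral_indic// setIT nuE//.
  congr (_ * _); rewrite [LHS]integral_mkcond; apply: eq_integral => y _.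
  by rewrite patchE indicE; case: (_ \in _); rewrite ?mul1e ?mul0e.
pose f_ := nnsfun_approx measurableT mf.
transitivity (lim (\int[nu]_x (f_ n x)%:E @[n --> \oo])).
  rewrite -monotone_convergence//=.
  - apply: eq_integral => ? /[!inE] xD; apply/esym/cvg_lim => //=.
    exact: cvg_nnsfun_approx.
  - by move=> n; exact/measurable_EFinP/measurable_funTS.
  - by move=> n ? _; rewrite lee_fin.
  - by move=> ? _ ? ? mn; rewrite lee_fin; exact/lefP/nd_nnsfun_approx.
under eq_fun do rewrite sE.
rewrite -monotone_convergence//=.
- apply: eq_integral => x /[!inE] xD; apply/cvg_lim => //=.
  apply: cvgeZr => //.
  by apply: cvg_nnsfun_approx.
- move=> n; have mn : measurable_fun setT (fun y => (f_ n y)%:E).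
    exact/measurable_EFinP/measurable_funTS.
  by apply: emeasurable_funM; [exact: mn|exact: mpE].
- by move=> n x _; rewrite mule_ge0// lee_fin.
- move=> x _ m n mn; apply: lee_wpmul2r; first by rewrite lee_fin.
  by rewrite lee_fin; have /lefP := nd_nnsfun_approx measurableT mf mn; apply.
Qed.

End density.

Section process_measurability.
Context d (T : measurableType d) (R : realType).

Lemma sigma_rv_measurable (X : T -> R) :
  measurable_fun setT X -> sigma_rv X `<=` measurable.
Proof.
move=> mX _ [B mB <-]; exact: mX.
Qed.

Lemma sigma_rvT (X : T -> R) : sigma_rv X setT.
Proof. by exists setT => //; rewrite setTI. Qed.

Lemma sigma_rvI (X : T -> R) : setI_closed (sigma_rv X).
Proof.
move=> _ _ [A mA <-] [B mB <-]; exists (A `&` B); first exact: measurableI.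
by rewrite preimage_setI setIACA setIid.
Qed.

Lemma measurable_fun_generate (G : set_system T) (X : T -> R) :
  sigma_rv X `<=` G -> measurable_fun (setT : set (g_sigma_algebraType G)) X.
Proof.
by move=> XG _ A mA; apply: sub_gen_smallest; apply: XG; exists A.
Qed.

Lemma generate_preimage (G : set_system T) d' (T' : measurableType d')
    (X : T -> T') (A : set T') :
  measurable_fun (setT : set (g_sigma_algebraType G)) X -> measurable A ->
  <<s G >> (X @^-1` A).
Proof. by move=> mX mA; have := mX measurableT _ mA; rewrite setTI. Qed.

Lemma sigma_process_le (I : Type) (X : I -> T -> R) :
  (forall i, measurable_fun setT (X i)) -> sigma_process X `<=` measurable.
Proof.
move=> mX; apply: sub_generate_measurable => A [i _].
exact: sigma_rv_measurable.
Qed.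

Lemma sigma_processT (I : Type) (X : I -> T -> R) : sigma_process X setT.
Proof. exact: (@measurableT _ (g_sigma_algebraType _)). Qed.

Lemma sigma_processI (I : Type) (X : I -> T -> R) :
  setI_closed (sigma_process X).
Proof. move=> A B; exact: (@measurableI _ (g_sigma_algebraType _)). Qed.

End process_measurability.

(** * Gaussian tails *)

Lemma is_derive1_continuous (R : realType) (f : R -> R) (x df : R) :
  is_derive x 1 f df -> {for x, continuous f}.
Proof.
move=> h; apply: differentiable_continuous; apply/derivable1_diffP.
exact: (@ex_derive _ _ _ _ _ _ _ h).
Qed.

Section normal_tail.
Context (R : realType).
Notation mu := (@lebesgue_measure R).
Implicit Types s a z : R.

(** The fundamental theorem of calculus from minus infinity. *)
Lemma is_derive_Phi z : is_derive z 1 (@Phi R) (normal_pdf 0 1 z).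
Proof.
have [] := @continuous_FTC1 R (normal_pdf 0 1) -oo%O z (z + 1) _ _ _ _.
- by rewrite ltrDl.
- apply: (integrableS measurableT) => //.
  exact: integrable_normal_pdf.
- by rewrite ltNyr.
- exact/continuous_normal_pdf/oner_neq0.
- move=> dP PE; have PD : 'D_1 (@Phi R) z = normal_pdf 0 1 z.
    by rewrite -PE derive1E.
  exact: (DeriveDef dP PD).
Qed.

Lemma cvg_Phi : @Phi R z @[z --> +oo] --> (1 : R).
Proof.
pose idR : measurableTypeR R -> R := idfun.
have mid : measurable_fun setT idR by exact: measurable_id.
pose X : {RV (normal_prob (0 : R) 1) >-> R} :=
  HB.pack idR (isMeasurableFun.Build _ _ _ _ _ mid).
by have /fine_cvg := cvg_cdfy1 X.
Qed.

Lemma normal_pdf_scale s x : 0 < s ->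
  normal_pdf 0 s x = normal_pdf 0 1 (x / s) * s^-1.
Proof.
move=> s0; have sN0 : s != 0 by rewrite gt_eqF.
rewrite !normal_pdfE ?oner_neq0// /normal_peak /normal_fun !subr0 expr1n mul1r.
rewrite -mulrnAr sqrtrM ?sqr_ge0// sqrtr_sqr gtr0_norm// invfM.
have -> : - x ^+ 2 / (s ^+ 2 *+ 2) = - (x / s) ^+ 2 / (1 *+ 2) by field.
by ring.
Qed.

Lemma is_derive_Phi_scale s (x : R) : 0 < s ->
  is_derive x 1 (fun y => Phi (y / s)) (normal_pdf 0 s x).
Proof.
move=> s0; rewrite normal_pdf_scale//.
have h1 : is_derive x 1 (fun y : R => y / s) s^-1.
  by apply: is_derive_eq; rewrite /GRing.scale/= mulr0 add0r mulr1.
have h2 := is_derive_Phi (x / s).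
exact: (@is_derive1_comp R (@Phi R) (fun y => y / s) x _ _ h2 h1).
Qed.

(** [fun y => Phi (y / s)] is a primitive of the density with limit 1 at
    infinity, which settles the scaling of the standard deviation without a
    change of variables. *)
Lemma normal_tailE s a : 0 < s ->
  normal_prob 0 s `[a, +oo[ = (1 - Phi (a / s))%:E.
Proof.
move=> s0; have sN0 : s != 0 by rewrite gt_eqF.
have dF x := is_derive_Phi_scale x s0.
rewrite /normal_prob.
rewrite (@ge0_continuous_FTC2y R (normal_pdf 0 s) (fun y => Phi (y / s)) a 1).
- by rewrite -EFinB.
- by move=> x _; exact: normal_pdf_ge0.
- apply: continuous_subspaceT; exact: continuous_normal_pdf.
- apply: (@cvg_comp _ _ _ (fun y => y / s) (@Phi R) _ +oo _ _ cvg_Phi).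
  by apply: gt0_cvgMly; rewrite ?invr_gt0.
- by move=> x _; exact: (@ex_derive _ _ _ _ _ _ _ (dF x)).
- by apply: cvg_at_right_filter; exact: (is_derive1_continuous (dF a)).
- by move=> x _; rewrite derive1E; exact: (@derive_val _ _ _ _ _ _ _ (dF x)).
Qed.

Lemma normal_prob_opp s a : s != 0 ->
  normal_prob 0 s `]-oo, - a] = normal_prob 0 s `[a, +oo[.
Proof.
move=> s0; rewrite /normal_prob ge0_integration_by_substitutionNy.
- apply: eq_integral => x _; rewrite /= !normal_pdfE// /normal_fun !subr0.
  by rewrite sqrrN.
- apply: continuous_subspaceT; exact: continuous_normal_pdf.
- by move=> x _; exact: normal_pdf_ge0.
Qed.

Lemma normal_tail0 s : s != 0 -> normal_prob 0 s `[0, +oo[ = (2^-1)%:E.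
Proof.
move=> s0; have h := normal_prob_opp 0 s0; rewrite oppr0 in h.
have hU : normal_prob 0 s `[0%R, +oo[ = (1 - normal_prob 0 s `]-oo, 0%R])%E.
  rewrite -probability_setC// setCitvl /normal_prob -integral_itv_obnd_cbnd//.
  apply/measurable_EFinP; apply: measurable_funTS.
  exact: measurable_normal_pdf.
move: hU; rewrite h.
have : normal_prob 0 s `[0%R, +oo[ \is a fin_num by rewrite fin_num_measure.
move=> /fineK <-; rewrite -EFinB => -[] hE; congr EFin.
lra.
Qed.

Lemma Phi_ge0 z : 0 <= Phi z :> R.
Proof. by rewrite /Phi fine_ge0. Qed.

Lemma Phi_le1 z : Phi z <= 1 :> R.
Proof.
rewrite /Phi -lee_fin fineK ?fin_num_measure//; exact: probability_le1.
Qed.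

Lemma Phi_ge_half z : 0 <= z -> 2^-1 <= Phi z.
Proof.
move=> z0.
have : (normal_prob 0 1 `[z, +oo[ <= normal_prob 0 1 `[0%R, +oo[)%E.
  apply: le_measure; rewrite ?inE//; apply: subset_itvr.
  by rewrite bnd_simp.
rewrite normal_tail0 ?oner_neq0// normal_tailE// divr1 lee_fin; lra.
Qed.

Lemma cvg_normal_pdf s : s != 0 ->
  normal_pdf 0 s x @[x --> (+oo : set_system R)] --> (0 : R).
Proof.
move=> s0.
have sqy : x ^+ 2 @[x --> (+oo : set_system R)] --> +oo.
  apply/cvgryPge => A; near=> x.
  have x1 : 1 <= x by near: x; apply: nbhs_pinfty_ge; rewrite num_real.
  have xA : A <= x by near: x; apply: nbhs_pinfty_ge; rewrite num_real.
  by apply: (le_trans xA); nra.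
pose g (x : R) := x ^+ 2 * (s ^+ 2 *+ 2)^-1.
have -> : normal_pdf 0 s = fun x => normal_peak s * expR (- g x).
  apply/funext => x; rewrite normal_pdfE// /normal_fun subr0 /g mulNr.
  by [].
rewrite -(mulr0 (normal_peak s)); apply: cvgM; first exact: cvg_cst.
apply: (@cvg_comp _ _ _ g (fun z => expR (- z)) _ (pinfty_nbhs R));
  last exact: cvgr_expR.
apply: gt0_cvgMly => //.
by rewrite invr_gt0 pmulrn_lgt0// exprn_even_gt0.
Unshelve. all: by end_near. Qed.

(** Mills' ratio.  For [y >= a] the density is at most [y / a] times itself, and
    [y] times the density has the primitive [- s ^+ 2] times the density. *)
Lemma normal_tail_le s a : 0 < s -> 0 < a ->
  1 - Phi (a / s) <= s ^+ 2 / a * normal_pdf 0 s a.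
Proof.
move=> s0 a0; have sN0 : s != 0 by rewrite gt_eqF.
have dF (x : R) : is_derive x 1 (fun y => - (s ^+ 2 / a) * normal_pdf 0 s y)
    (x / a * normal_pdf 0 s x).
  rewrite normal_pdfE// /normal_fun.
  apply: is_derive_eq; rewrite /GRing.scale/= !subr0.
  by set e := expR _; field; rewrite sN0 gt_eqF.
have cf : continuous (fun x : R => x / a * normal_pdf 0 s x).
  move=> x; apply: cvgM; last exact: continuous_normal_pdf.
  by apply: cvgM; [exact: cvg_id|exact: cvg_cst].
have F0 : - (s ^+ 2 / a) * normal_pdf 0 s x @[x --> (+oo : set_system R)]
    --> (0 : R).
  rewrite -[X in _ --> X](mulr0 (- (s ^+ 2 / a))).
  apply: cvgM; first exact: cvg_cst.
  exact: cvg_normal_pdf.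
rewrite -lee_fin -normal_tailE// /normal_prob.
apply: (@le_trans _ _ (\int[mu]_(x in `[a, +oo[) (x / a * normal_pdf 0 s x)%:E)%E).
  apply: ge0_le_integral => //.
  - by move=> x _; rewrite lee_fin normal_pdf_ge0.
  - apply/measurable_EFinP; apply: measurable_funTS.
    exact: measurable_normal_pdf.
  - apply/measurable_EFinP; apply: measurable_funTS.
    exact: continuous_measurable_fun.
  - move=> x /=; rewrite in_itv/= andbT lee_fin => ax.
    by rewrite ler_peMl ?normal_pdf_ge0// ler_pdivlMr// mul1r.
rewrite (@ge0_continuous_FTC2y R _ _ a 0 _ _ _
  (fun x _ => @ex_derive _ _ _ _ _ _ _ (dF x))).
- by rewrite -EFinB sub0r mulNr opprK.
- move=> x ax; rewrite mulr_ge0 ?normal_pdf_ge0// divr_ge0// ltW//.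
  exact: lt_le_trans ax.
- exact: continuous_subspaceT.
- exact: F0.
- by apply: cvg_at_right_filter; exact: (is_derive1_continuous (dF a)).
- by move=> x _; rewrite derive1E; exact: (@derive_val _ _ _ _ _ _ _ (dF x)).
Qed.

End normal_tail.

(** * Comparison of measures and level sets *)

Lemma le_measure_ae d (T : measurableType d) (R : realType)
    (mu : {measure set T -> \bar R}) (A B : set T) :
  measurable A -> measurable B -> {ae mu, forall w, A w -> B w} ->
  (mu A <= mu B)%E.
Proof.
move=> mA mB [N [mN N0 sN]].
apply: (@le_trans _ _ (mu (B `|` N))).
  apply: le_measure; rewrite ?inE//; first exact: measurableU.
  move=> w Aw; have [Bw|nBw] := pselect (B w); [by left|right; apply: sN].
  by move=> /(_ Aw).
have BN : (mu B + mu N <= mu B)%E by rewrite N0 adde0.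
exact: (le_trans (measureU2 _ mB mN)).
Qed.

Lemma nondecreasing_bigcup_measure_le d (T : measurableType d) (R : realType)
    (mu : {measure set T -> \bar R}) (F : (set T)^nat) (c : \bar R) :
  (forall m, measurable (F m)) -> nondecreasing_seq F ->
  (forall m, (mu (F m) <= c)%E) -> (mu (\bigcup_m F m) <= c)%E.
Proof.
move=> mF ndF Fc.
have h := nondecreasing_cvg_mu (mu := mu) mF (bigcupT_measurable _ mF) ndF.
rewrite -(cvg_lim _ h)//; apply: lime_le.
  by apply/cvg_ex; eexists; exact: h.
by apply: nearW => m; exact: Fc.
Qed.

Section level_sets.
Context d (T : measurableType d) (R : realType).
Implicit Types (f : T -> R) (a : R).

Lemma measurable_gt f a : measurable_fun setT f ->
  measurable [set w | (a < f w)%R].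
Proof.
move=> mf; have := mf measurableT _ (measurable_itv `]a, +oo[); rewrite setTI.
by congr measurable; apply/seteqP; split=> w /=; rewrite in_itv/= andbT.
Qed.

End level_sets.

(** * Sums of exponential variables *)

Section exponential_tail.
Context (R : realType).
Local Notation mu := (@lebesgue_measure R).

Lemma exponential_prob_lt0 : exponential_prob (1 : R) `]-oo, 0[ = 0.
Proof.
rewrite /exponential_prob integral0_eq// => y /=; rewrite in_itv/= => y0.
by rewrite lt0_exponential_pdf.
Qed.

Lemma exponential_prob_ltE (l : R) : 0 < l ->
  exponential_prob (1 : R) `]-oo, l[ = (1 - expR (- l))%:E.
Proof.
move=> l0.
have mp D : measurable_fun D (fun y => (exponential_pdf (1 : R) y)%:E).
  by apply/measurable_EFinP; apply: measurable_funTS; exact: measurable_exponential_pdf.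
rewrite /exponential_prob integral_itv_bndo_bndc//.
rewrite -/(exponential_prob 1 _).
have -> : `]-oo, l]%classic = `]-oo, 0[ `|` `[0, l] :> set R.
  by rewrite -itv_bndbnd_setU// bnd_simp ltW.
transitivity (exponential_prob (1 : R) `]-oo, 0%R[ + exponential_prob 1 `[0%R, l])%E.
  apply: ge0_integral_setU => //.
  - exact: mp.
  - by move=> y _; rewrite lee_fin exponential_pdf_ge0.
  - apply/disj_setPS => y /= []; rewrite !in_itv/= => y0 /andP[y0' _].
    by move: y0; rewrite ltNge y0'.
rewrite exponential_prob_lt0 add0e exponential_prob_itv0c// mulN1r.
by rewrite EFinB.
Qed.

End exponential_tail.

Section exponential_sums.
Context d (T : measurableType d) (R : realType) (P : probability T R).
Variable Y : nat -> {RV P >-> R}.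
Hypothesis Yexp : forall (i : nat) (A : set R), measurable A ->
  distribution P (Y i) A = exponential_prob 1 A.
Hypothesis Yind : mutually_independent P (fun i => sigma_rv (Y i)).
Local Notation mu := (@lebesgue_measure R).

Definition block_sum (k j : nat) (w : T) : R := \sum_(i < j) Y (k + i)%N w.

(** The transition operator of the random walk with standard exponential steps:
    the mean of [f] at [u] plus one step. *)
Definition exp_shift (f : R -> \bar R) (u : R) : \bar R :=
  (\int[mu]_(y in `[0%R, +oo[) (f (u + y)%R * (expR (- y))%:E))%E.

Lemma measurable_rv (X : {RV P >-> R}) : measurable_fun setT X.
Proof. exact: measurable_funP. Qed.

Lemma measurable_block_sum k j : measurable_fun setT (block_sum k j).
Proof. by apply: measurable_sum => i; exact: measurable_rv. Qed.

Definition sigma_block (J : set nat) : set_system T :=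
  <<s \bigcup_(i in J) sigma_rv (Y i) >>.

Lemma sigma_block_sum J k j A : (forall i, (i < j)%N -> J (k + i)%N) ->
  measurable A -> sigma_block J (block_sum k j @^-1` A).
Proof.
move=> kJ mA; apply: generate_preimage => //.
apply: measurable_sum => i; apply: measurable_fun_generate => B YB.
by exists (k + i)%N => //; exact: kJ.
Qed.

Lemma independent2_sigma_block J1 J2 : J1 `&` J2 = set0 ->
  independent2 P (sigma_block J1) (sigma_block J2).
Proof.
move=> J12; apply: independent2_blocks => //.
- by move=> i; apply: sigma_rv_measurable; exact: measurable_rv.
- by move=> i; exact: sigma_rvI.
- by move=> i; exact: sigma_rvT.
Qed.

Lemma ae_Y_ge0 : {ae P, forall w, forall i, 0 <= Y i w}.
Proof.
have h i : {ae P, forall w, 0 <= Y i w}.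
  exists (Y i @^-1` `]-oo, 0%R[); split.
  - exact: measurable_funPTI.
  - by have := Yexp i (measurable_itv `]-oo, 0%R[); rewrite exponential_prob_lt0.
  - by move=> w /= /negP; rewrite -ltNge in_itv.
exact: (ae_foralln h).
Qed.

Lemma block_sum_ge0 k j w : (forall i, 0 <= Y i w) -> 0 <= block_sum k j w.
Proof. by move=> Y0; apply: sumr_ge0 => i _; exact: Y0. Qed.

Lemma block_sumS k j w : block_sum k j.+1 w = block_sum k j w + Y (k + j)%N w.
Proof. by rewrite /block_sum big_ord_recr. Qed.

Lemma integral_exp_shift i (f : R -> \bar R) (u : R) :
  measurable_fun setT f -> (forall y, 0 <= f y)%E ->
  (\int[P]_w f (u + Y i w)%R = exp_shift f u)%E.
Proof.
move=> mf f0.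
have mfu : measurable_fun setT (fun y : R => f (u + y)).
  by apply: measurableT_comp => //; exact: measurable_funD.
transitivity (\int[distribution P (Y i)]_y f (u + y)%R)%E.
  by rewrite ge0_integral_distribution.
have p0 y : 0 <= exponential_pdf (1 : R) y by exact: exponential_pdf_ge0.
rewrite (ge0_integral_density (measurable_exponential_pdf 1) p0 (Yexp i))//.
rewrite /exp_shift [RHS]integral_mkcond; apply: eq_integral => y _.
rewrite patchE /exponential_pdf patchE; case: ifPn => _; last by rewrite mule0.
by rewrite mul1r mulN1r.
Qed.

Lemma measurable_exp_shift (i : nat) (f : R -> \bar R) :
  measurable_fun setT f -> (forall y, 0 <= f y)%E ->
  measurable_fun setT (exp_shift f).
Proof.
move=> mf f0.
have -> : exp_shift f = fun u => (\int[P]_w f (u + Y i w)%R)%E.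
  by apply/funext => u; rewrite integral_exp_shift.
have mF : measurable_fun setT (fun z : R * T => f (z.1 + Y i z.2)).
  apply: measurableT_comp => //; apply: measurable_funD => //.
  exact: measurableT_comp.
by apply: (measurable_fun_fubini_tonelli_F (m2 := P) _ mF) => z; exact: f0.
Qed.

(** One step of the walk.  The last summand is independent of the others and is
    integrated first; partial sums are almost surely nonnegative, so the
    comparison of [exp_shift f] with [g] matters on the half-line only. *)
Lemma integral_block_sumS k j (f g : R -> \bar R) :
  measurable_fun setT f -> (forall y, 0 <= f y)%E ->
  measurable_fun setT g -> (forall y, 0 <= g y)%E ->
  (forall u : R, (0 <= u)%R -> exp_shift f u <= g u)%E ->
  (\int[P]_w f (block_sum k j.+1 w) <= \int[P]_w g (block_sum k j w))%E.
Proof.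
move=> mf f0 mg g0 fg.
have mS := measurable_block_sum k j.
have mF : measurable_fun setT (fun z : R * R => f (z.1 + z.2)).
  by apply: measurableT_comp => //; exact: measurable_funD.
have -> : (\int[P]_w f (block_sum k j.+1 w) =
    \int[P]_w \int[P]_v f (block_sum k j w + Y (k + j)%N v)%R)%E.
  rewrite -(independent_fubini mS (measurable_rv (Y (k + j)%N)) _ mF)//.
    by apply: eq_integral => w _; rewrite block_sumS.
  move=> A B mA mB.
  apply: (@independent2_sigma_block [set i | (i < k + j)%N] [set (k + j)%N]).
  - by apply/seteqP; split=> // i /= [ij ijE]; rewrite ijE ltnn in ij.
  - by apply: sigma_block_sum => // i ij /=; rewrite ltn_add2l.
  - by apply: sub_gen_smallest; exists (k + j)%N => //; exists B => //; rewrite setTI.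
under eq_integral do rewrite integral_exp_shift//.
apply: ae_ge0_le_integral => //.
- move=> w _; apply: integral_ge0 => y _.
  by rewrite mule_ge0// lee_fin expR_ge0.
- by apply: measurableT_comp => //; exact: (measurable_exp_shift (k + j)%N).
- exact: measurableT_comp.
- apply: filterS ae_Y_ge0 => w Yw _; exact/fg/block_sum_ge0.
Qed.

(** The hypothesis makes [G (S_n)] plus the sum of [h (S_j)] over [1 <= j <= n] a
    supermartingale started at [G 0].  The typical [G u] is the integral of [h]
    over [[u, +oo[]: then [G 0] is the mean of the sum of [h] over the points of
    a Poisson process of unit rate. *)
Lemma renewal_bound k (h G : R -> \bar R) :
  measurable_fun setT h -> (forall y, 0 <= h y)%E ->
  measurable_fun setT G -> (forall y, 0 <= G y)%E ->
  (forall u : R, (0 <= u)%R -> exp_shift (h \+ G) u <= G u)%E ->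
  forall n, (\sum_(j < n) \int[P]_w h (block_sum k j.+1 w) <= G 0%R)%E.
Proof.
move=> mh h0 mG G0 hG n.
have mhG : measurable_fun setT (h \+ G)%E by exact: emeasurable_funD.
suff : (\sum_(j < n) \int[P]_w h (block_sum k j.+1 w)
    + \int[P]_w G (block_sum k n w) <= G 0%R)%E.
  by apply: le_trans; rewrite leeDl// integral_ge0.
elim: n => [|n IH].
  rewrite big_ord0 add0e; under eq_integral do rewrite /block_sum big_ord0.
  have h1 : (G 0%R * P setT <= G 0%R)%E by rewrite (@probability_setT _ _ _ P) mule1.
  by rewrite integral_cst.
apply: le_trans IH; rewrite big_ord_recr/= -addeA leeD2l//.
rewrite -ge0_integralD//; last 2 first.
- by apply: measurableT_comp => //; exact: measurable_block_sum.
- by apply: measurableT_comp => //; exact: measurable_block_sum.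
apply: (@integral_block_sumS k n (fun u => h u + G u)%E G) => // y; exact: adde_ge0.
Qed.

End exponential_sums.

(** * Small values of the sums *)

Section truncated_power.
Context (R : realType).
Local Notation mu := (@lebesgue_measure R).

(** The [m]-fold iterate of integration from [u] to [l] applied to the indicator
    of [u < l].  The indicator keeps the value at [m = 0] correct for [u >= l],
    where a positive part raised to the power 0 would give 1. *)
Definition truncated_power (l : R) (m : nat) (u : R) : \bar R :=
  ((l - u) ^+ m / m`!%:R * \1_(`]-oo, l[) u)%:E.

Lemma truncated_power_ge0 l m u : (0 <= truncated_power l m u)%E.
Proof.
rewrite /truncated_power lee_fin indicE.
case: (boolP (u \in _)) => ul /=; rewrite ?mulr0// mulr1 divr_ge0//.
by rewrite exprn_ge0// subr_ge0 ltW//; move: ul; rewrite inE/= in_itv.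
Qed.

Lemma measurable_truncated_power l m : measurable_fun setT (truncated_power l m).
Proof.
apply/measurable_EFinP; apply: measurable_funM => //.
apply: measurable_funM => //; apply: measurable_funX.
by apply: measurable_funB.
Qed.

Lemma integral_power_itv (L : R) (m : nat) : 0 < L ->
  (\int[mu]_(y in `[0%R, L]) ((L - y) ^+ m / m`!%:R)%:E
    = (L ^+ m.+1 / m.+1`!%:R)%:E)%E.
Proof.
move=> L0.
have f0 : (m.+1`!%:R : R) != 0 by rewrite pnatr_eq0 -lt0n fact_gt0.
(* differentiating y |-> (L - y) ^+ n for a variable n needs the power in the
   ring of functions *)
have dX n (y : R) : is_derive y 1 (fun y => (L - y) ^+ n)
    (- (n%:R * (L - y) ^+ n.-1)).
  have h : is_derive y 1 (fun y : R => L - y) (-1).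
    by apply: is_derive_eq; ring.
  have := is_deriveX n h; rewrite exprfctE => /is_derive_eq; apply.
  by rewrite /GRing.scale/= mulrN1.
have dF (y : R) : is_derive y 1 (fun y => - ((L - y) ^+ m.+1 / m.+1`!%:R))
    ((L - y) ^+ m / m`!%:R).
  have dXm := dX m.+1 y; apply: is_derive_eq; rewrite /GRing.scale/=.
  have m0 : (m`!%:R : R) != 0 by rewrite pnatr_eq0 -lt0n fact_gt0.
  rewrite factS natrM; field.
  by rewrite m0/= nat1r pnatr_eq0.
have cF y := is_derive1_continuous (dF y).
rewrite (@continuous_FTC2 R _ (fun y => - ((L - y) ^+ m.+1 / m.+1`!%:R)))//.
- by rewrite subrr subr0 expr0n mul0r oppr0 -EFinB sub0r opprK.
- apply: continuous_subspaceT => y; apply: cvgM; last exact: cvg_cst.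
  exact: is_derive1_continuous (dX m y).
- split.
  + by move=> y _; exact: (@ex_derive _ _ _ _ _ _ _ (dF y)).
  + by apply: cvg_at_right_filter; exact: cF.
  + by apply: cvg_at_left_filter; exact: cF.
- by move=> y _; rewrite derive1E; exact: (@derive_val _ _ _ _ _ _ _ (dF y)).
Qed.

(** The exponential density is at most 1, and integrating the [m]-th power over
    [[0, l - u]] gives the next one. *)
Lemma exp_shift_truncated_power l m u :
  (exp_shift (truncated_power l m) u <= truncated_power l m.+1 u)%E.
Proof.
have mT : measurable_fun setT
    (fun y : R => truncated_power l m (u + y) * (expR (- y))%:E)%E.
  apply: emeasurable_funM.
    apply: measurableT_comp; first exact: measurable_truncated_power.
    exact: measurable_funD.
  apply/measurable_EFinP; apply: measurableT_comp => //.
have [lu|ul] := leP l u.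
  rewrite /exp_shift integral0_eq; first exact: truncated_power_ge0.
  move=> y /=; rewrite in_itv/= andbT => y0.
  rewrite /truncated_power indicE memNset ?mulr0 ?mul0e//=.
  rewrite in_itv/= => uyl; lra.
have L0 : 0 < l - u by rewrite subr_gt0.
rewrite [leRHS](_ : _ = ((l - u) ^+ m.+1 / m.+1`!%:R)%:E); last first.
  by rewrite /truncated_power indicE mem_set ?mulr1//= in_itv.
rewrite -integral_power_itv// /exp_shift integral_mkcond [leRHS]integral_mkcond.
apply: ge0_le_integral => //.
- move=> y _; apply: erestrict_ge0 => z _.
  by rewrite mule_ge0 ?truncated_power_ge0// lee_fin expR_ge0.
- by apply/measurable_restrict => //; apply: measurable_funTS.
- apply/measurable_restrict => //; apply: measurable_funTS.
  apply/measurable_EFinP; apply: measurable_funM => //.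
  by apply: measurable_funX; apply: measurable_funB.
- move=> y _; rewrite !patchE.
  case: ifPn => [|_]; last first.
    case: ifPn => //; rewrite inE/= in_itv/= => /andP[_ yL].
    by rewrite lee_fin divr_ge0// exprn_ge0// subr_ge0.
  rewrite inE/= in_itv/= andbT => y0.
  case: ifPn => [|].
    rewrite inE/= in_itv/= => /andP[_ yL].
    rewrite /truncated_power -EFinM lee_fin opprD addrA.
    have p0 : 0 <= (l - u - y) ^+ m / m`!%:R.
      by rewrite divr_ge0// exprn_ge0// subr_ge0.
    have e1 : expR (- y) <= 1 by rewrite -expR0 ler_expR oppr_le0.
    rewrite -[leLHS]mulrA ler_piMr// indicE; case: (_ \in _).
      by rewrite mul1r.
    by rewrite mul0r.
  rewrite notin_setE/= in_itv/= y0/= => /negP; rewrite -ltNge => yL.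
  rewrite /truncated_power indicE memNset ?mulr0 ?mul0e//=.
  rewrite in_itv/= => uyl; lra.
Qed.

End truncated_power.

Section exponential_sum_tail.
Context d (T : measurableType d) (R : realType) (P : probability T R).
Variable Y : nat -> {RV P >-> R}.
Hypothesis Yexp : forall (i : nat) (A : set R), measurable A ->
  distribution P (Y i) A = exponential_prob 1 A.
Hypothesis Yind : mutually_independent P (fun i => sigma_rv (Y i)).

(** Each summand removed from the sum raises the exponent by one; with no
    summand left the function is evaluated at 0. *)
Lemma integral_truncated_power (l : R) k j m : 0 < l ->
  (\int[P]_w truncated_power l m (block_sum Y k j w)
    <= (l ^+ (m + j) / (m + j)`!%:R)%:E)%E.
Proof.
move=> l0; elim: j m => [|j IH] m.
  rewrite addn0; under eq_integral do rewrite /block_sum big_ord0.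
  have -> : truncated_power l m 0 = (l ^+ m / m`!%:R)%:E.
    by rewrite /truncated_power subr0 indicE mem_set ?mulr1//= in_itv.
  have PT : ((l ^+ m / m`!%:R)%:E * P setT <= (l ^+ m / m`!%:R)%:E)%E.
    by rewrite (@probability_setT _ _ _ P) mule1.
  by rewrite integral_cst.
rewrite addnS -addSn; apply: le_trans (IH m.+1).
apply: integral_block_sumS => //.
- exact: measurable_truncated_power.
- exact: truncated_power_ge0.
- exact: measurable_truncated_power.
- exact: truncated_power_ge0.
- move=> u _; exact: exp_shift_truncated_power.
Qed.

Lemma measurable_block_sum_lt (l : R) k j :
  measurable [set w | (block_sum Y k j w < l)%R].
Proof.
have := measurable_block_sum Y k j measurableT (measurable_itv `]-oo, l[).
by rewrite setTI.
Qed.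

Lemma prob_block_sum_lt (l : R) k j : 0 < l ->
  (P [set w | (block_sum Y k j w < l)%R] <= (l ^+ j / j`!%:R)%:E)%E.
Proof.
move=> l0; have := integral_truncated_power k j 0 l0; rewrite add0n.
apply: le_trans.
rewrite -[X in P X]setIT -integral_indic//; last exact: measurable_block_sum_lt.
rewrite le_eqVlt; apply/orP; left; apply/eqP/eq_integral => w _.
rewrite /truncated_power expr0 fact0 divr1 mul1r !indicE; congr (_%:R%:E).
Qed.

Lemma prob_Y_lt (l : R) i : 0 < l ->
  P [set w | (Y i w < l)%R] = (1 - expR (- l))%:E.
Proof.
by move=> l0; rewrite -exponential_prob_ltE// -(Yexp i).
Qed.

(** If the whole sum is below [l], then so are the sum of the first [j] terms and
    the last term, and these two are independent. *)
Lemma prob_block_sumS_lt (l : R) j : 0 < l ->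
  (P [set w | (block_sum Y 0 j.+1 w < l)%R] <=
    (l ^+ j / j`!%:R * (1 - expR (- l)))%:E)%E.
Proof.
move=> l0.
pose A := [set w | (block_sum Y 0 j w < l)%R].
have mA : measurable A by exact: measurable_block_sum_lt.
pose B := [set w | (Y j w < l)%R].
have BE : B = Y j @^-1` `]-oo, l[.
  by apply/seteqP; split => w /=; rewrite in_itv.
have mB : measurable B by rewrite BE; exact: measurable_funPTI.
apply: (@le_trans _ _ (P (A `&` B))).
  apply: le_measure_ae; [exact: measurable_block_sum_lt|exact: measurableI|].
  apply: filterS (ae_Y_ge0 Yexp) => w Y0 /=; rewrite block_sumS add0n => h.
  have S0 : 0 <= block_sum Y 0 j w by exact: block_sum_ge0.
  by split; rewrite /A/B /=; have := Y0 j; lra.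
have -> : (P (A `&` B) = P A * P B)%E.
  apply: (@independent2_sigma_block _ _ _ _ Y Yind [set i | (i < j)%N] [set j]).
  - by apply/seteqP; split=> // i /= [ij ijE]; rewrite ijE ltnn in ij.
  - rewrite (_ : A = block_sum Y 0 j @^-1` `]-oo, l[).
      by apply: sigma_block_sum.
    by apply/seteqP; split => w /=; rewrite in_itv.
  - rewrite BE; apply: sub_gen_smallest; exists j => //.
    by exists `]-oo, l[%classic; [exact: measurable_itv|rewrite setTI].
rewrite prob_Y_lt// EFinM lee_wpmul2r//.
  by rewrite lee_fin subr_ge0 -expR0 ler_expR oppr_le0 ltW.
exact: prob_block_sum_lt.
Qed.

End exponential_sum_tail.

(** * The potential of the barrier *)

Section hitting_potential.
Context (R : realType) (b x c : R).
Hypothesis b0 : 0 < b.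
Hypothesis xc : x < c.
Local Notation mu := (@lebesgue_measure R).
Local Notation s := (Num.sqrt b).

(** Let the arrival of index [k] be at most [x], and let [u] be the sum of the
    exponential variables between it and a later arrival.  For the path of that
    later arrival to exceed [c], drift removed, its Brownian part must exceed at
    least this level. *)
Definition barrier (u : R) : R := c + ln (expR (- x) + u).

(** Four times the Mills bound for the tail of [W b] at [barrier u], with the
    factor [b / barrier u] replaced by its maximum [b / (c - x)] over
    [u >= 0]. *)
Definition hit_density (u : R) : R :=
  4 * (b / (c - x)) * normal_pdf 0 s (barrier u).

(** The integral of [hit_density] over [[u, +oo[] in closed form: substituting
    [v = barrier u] turns it into a Gaussian integral weighted by [expR v], in
    which the weight moves the mean from 0 to [b]. *)
Definition hit_potential (u : R) : R :=
  4 * expR (- c) * (b / (c - x)) * expR (b / 2)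
    * (1 - Phi ((barrier u - b) / s)).

Let s0 : 0 < s. Proof. by rewrite sqrtr_gt0. Qed.
Let sN0 : s != 0. Proof. by rewrite gt_eqF. Qed.
Let d0 : 0 < c - x. Proof. by rewrite subr_gt0. Qed.

Lemma hit_density_ge0 u : 0 <= hit_density u.
Proof. by rewrite !mulr_ge0 ?normal_pdf_ge0 ?invr_ge0 ?(ltW b0) ?(ltW d0). Qed.

Lemma hit_potential_ge0 u : 0 <= hit_potential u.
Proof.
by rewrite !mulr_ge0 ?expR_ge0 ?invr_ge0 ?(ltW b0) ?(ltW d0) ?subr_ge0 ?Phi_le1.
Qed.

Lemma hit_potential_le u :
  hit_potential u <= 4 * expR (- c) * (b / (c - x)) * expR (b / 2).
Proof.
rewrite ler_piMr//; last by rewrite gerBl Phi_ge0.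
by rewrite !mulr_ge0 ?expR_ge0 ?invr_ge0 ?(ltW b0) ?(ltW d0).
Qed.

Lemma hit_potential0 : hit_potential 0 = bound_cond_error b x c.
Proof. by rewrite /hit_potential /barrier addr0 expRK. Qed.

Lemma barrier_ge u : 0 <= u -> c - x <= barrier u.
Proof.
move=> u0; rewrite /barrier lerD2l -[leLHS]expRK ler_ln ?posrE ?expR_gt0//.
  by rewrite lerDl.
by rewrite ltr_wpDr// expR_gt0.
Qed.

Lemma normal_tail_hit_density u : 0 <= u ->
  4 * (1 - Phi (barrier u / s)) <= hit_density u.
Proof.
move=> u0; have bu := barrier_ge u0.
have bu0 : 0 < barrier u by exact: lt_le_trans bu.
rewrite /hit_density -mulrA ler_wpM2l//.
apply: (le_trans (normal_tail_le s0 bu0)).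
rewrite sqr_sqrtr ?(ltW b0)// ler_wpM2r ?normal_pdf_ge0// ler_wpM2l ?(ltW b0)//.
by rewrite lef_pV2.
Qed.

Lemma is_derive_barrier (u : R) : 0 <= u ->
  is_derive u 1 barrier (expR (- x) + u)^-1.
Proof.
move=> u0.
have v0 : 0 < expR (- x) + u by rewrite ltr_wpDr// expR_gt0.
have h1 : is_derive u 1 (fun u => expR (- x) + u) 1.
  by apply: is_derive_eq; ring.
have h2 := is_derive1_ln v0.
have h3 := @is_derive1_comp R (@ln R) (fun u => expR (- x) + u) u _ _ h2 h1.
by apply: is_derive_eq; ring.
Qed.

(** Completing the square. *)
Lemma normal_pdf_shift (z : R) :
  normal_pdf 0 s (z - b) * expR (b / 2) = normal_pdf 0 s z * expR z.
Proof.
rewrite !normal_pdfE// /normal_fun -!mulrA -!expRD !subr0 sqr_sqrtr ?(ltW b0)//.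
congr (_ * expR _); field.
by rewrite gt_eqF.
Qed.

Lemma is_derive_hit_potential (u : R) : 0 <= u ->
  is_derive u 1 hit_potential (- hit_density u).
Proof.
move=> u0.
have v0 : 0 < expR (- x) + u by rewrite ltr_wpDr// expR_gt0.
have h1 := is_derive_barrier u0.
have h2 : is_derive u 1 (fun u => barrier u - b) (expR (- x) + u)^-1.
  by apply: is_derive_eq; ring.
have h3 := is_derive_Phi_scale (barrier u - b) s0.
have h4 := @is_derive1_comp R (fun y => Phi (y / s)) (fun u => barrier u - b)
  u _ _ h3 h2.
have h5 : is_derive u 1 (fun u => Phi ((barrier u - b) / s))
  (normal_pdf 0 s (barrier u - b) * (expR (- x) + u)^-1) by exact: h4.
apply: is_derive_eq; rewrite /GRing.scale/= /hit_density.
have e1 := normal_pdf_shift (barrier u).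
have e2 : expR (barrier u) = expR c * (expR (- x) + u).
  by rewrite /barrier expRD lnK ?posrE.
rewrite e2 in e1.
have e3 : expR (- c) * expR c = 1 by rewrite -expRD addNr expR0.
have -> : normal_pdf 0 s (barrier u) =
    normal_pdf 0 s (barrier u) * (expR (- c) * expR c) by rewrite e3 mulr1.
move: e1; move: (normal_pdf 0 s _) (normal_pdf 0 s _) => p q e1.
have vN0 : expR (- x) + u != 0 by rewrite gt_eqF.
have dN0 : c - x != 0 by rewrite gt_eqF.
transitivity (- (4 * expR (- c) * (b / (c - x)) * (q * expR (b / 2))
  / (expR (- x) + u))); first by field; rewrite vN0 dN0.
by rewrite e1; field; rewrite vN0 dN0.
Qed.

Lemma continuous_hit_density (u : R) : 0 <= u ->
  {for u, continuous hit_density}.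
Proof.
move=> u0; apply: cvgM; first exact: cvg_cst.
apply: (continuous_comp (is_derive1_continuous (is_derive_barrier u0))).
exact: continuous_normal_pdf.
Qed.

(** Since the derivative of the potential is [- hit_density], the integrand
    [(hit_density + hit_potential) (u + y) * expR (- y)] has the primitive
    [- hit_potential (u + y) * expR (- y)] in [y]. *)
Lemma exp_shift_hit (u : R) : 0 <= u ->
  (exp_shift (fun v => (hit_density v)%:E + (hit_potential v)%:E) u
     <= (hit_potential u)%:E)%E.
Proof.
move=> u0; rewrite /exp_shift.
pose f (y : R) := (hit_density (u + y) + hit_potential (u + y)) * expR (- y).
pose F (y : R) := - (hit_potential (u + y) * expR (- y)).
have dF (y : R) : 0 <= y -> is_derive y 1 F (f y).
  move=> y0.
  have h1 : is_derive y 1 (fun y => u + y) 1.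
    by apply: is_derive_eq; ring.
  have h2 := is_derive_hit_potential (addr_ge0 u0 y0).
  have h3 : is_derive y 1 (fun y => hit_potential (u + y)) _ :=
    @is_derive1_comp R hit_potential (fun y => u + y) y _ _ h2 h1.
  apply: is_derive_eq; rewrite /GRing.scale/= /f; ring.
have F0 : F y @[y --> (+oo : set_system R)] --> (0 : R).
  rewrite -[X in _ --> X]oppr0; apply: cvgN.
  pose K := 4 * expR (- c) * (b / (c - x)) * expR (b / 2).
  have K0 : K * expR (- y) @[y --> (+oo : set_system R)] --> (0 : R).
    rewrite -[X in _ --> X](mulr0 K); apply: cvgM; first exact: cvg_cst.
    exact: cvgr_expR.
  apply: (squeeze_cvgr _ (cvg_cst 0) K0); near=> y.
  by rewrite mulr_ge0 ?hit_potential_ge0 ?expR_ge0//= ler_wpM2r ?expR_ge0//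
    hit_potential_le.
under eq_integral do rewrite -EFinD -EFinM.
rewrite (@ge0_continuous_FTC2y R f F 0 0).
- by rewrite -EFinB sub0r opprK addr0 oppr0 expR0 mulr1.
- move=> y y0; rewrite mulr_ge0 ?expR_ge0//.
  by rewrite addr_ge0 ?hit_density_ge0 ?hit_potential_ge0.
- apply: continuous_in_subspaceT => y; rewrite inE/= in_itv/= andbT => y0.
  apply: cvgM; last first.
    apply: (@continuous_comp _ _ _ (fun z : R => - z) expR).
      exact: opp_continuous.
    exact: continuous_expR.
  have cu : {for y, continuous (fun z : R => u + z)}.
    by apply: cvgD; [exact: cvg_cst|exact: cvg_id].
  have uy0 := addr_ge0 u0 y0.
  apply: cvgD.
    exact: (continuous_comp cu (continuous_hit_density uy0)).
  exact: (continuous_comp cu (is_derive1_continuous (is_derive_hit_potential uy0))).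
- exact: F0.
- by move=> y y0; exact: (@ex_derive _ _ _ _ _ _ _ (dF y (ltW y0))).
- by apply: cvg_at_right_filter; exact: (is_derive1_continuous (dF 0 (lexx _))).
- move=> y; rewrite in_itv/= andbT => y0; rewrite derive1E.
  exact: (@derive_val _ _ _ _ _ _ _ (dF y (ltW y0))).
Unshelve. all: by end_near. Qed.

Lemma measurable_barrier : measurable_fun setT barrier.
Proof.
apply: measurable_funD => //; apply: measurableT_comp; first exact: measurable_ln.
exact: measurable_funD.
Qed.

Lemma measurable_hit_density : measurable_fun setT hit_density.
Proof.
apply: measurable_funM => //; apply: measurableT_comp.
  exact: measurable_normal_pdf.
exact: measurable_barrier.
Qed.

Lemma measurable_Phi : measurable_fun setT (@Phi R).
Proof.
apply: continuous_measurable_fun => z.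
exact: is_derive1_continuous (is_derive_Phi z).
Qed.

Lemma measurable_hit_potential : measurable_fun setT hit_potential.
Proof.
apply: measurable_funM => //; apply: measurable_funB => //.
apply: measurableT_comp; first exact: measurable_Phi.
apply: measurable_funM => //; apply: measurable_funB => //.
exact: measurable_barrier.
Qed.

(** The value of the potential at 0 is the bound of the conditional error
    probability. *)
Lemma sum_hit_density_le d (T : measurableType d) (P : probability T R)
    (Y : nat -> {RV P >-> R}) :
  (forall (i : nat) (A : set R), measurable A ->
    distribution P (Y i) A = exponential_prob 1 A) ->
  mutually_independent P (fun i => sigma_rv (Y i)) ->
  forall k n, (\sum_(j < n) \int[P]_w (hit_density (block_sum Y k j.+1 w))%:E
    <= (bound_cond_error b x c)%:E)%E.
Proof.
move=> Yexp Yind k n; rewrite -hit_potential0.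
apply: (@renewal_bound _ _ _ _ Y Yexp Yind k
  (EFin \o hit_density) (EFin \o hit_potential)).
- by apply/measurable_EFinP; exact: measurable_hit_density.
- by move=> y; rewrite /= lee_fin hit_density_ge0.
- by apply/measurable_EFinP; exact: measurable_hit_potential.
- by move=> y; rewrite /= lee_fin hit_potential_ge0.
- exact: exp_shift_hit.
Qed.

End hitting_potential.

(** * Maxima of Brownian motion *)

Section levy.
Context d (T : measurableType d) (R : realType) (P : probability T R).

(** Decompose along the first index [j] at which [S] exceeds [a].  Given that,
    with probability at least one half the walk does not end below [S j], and
    then [S n] exceeds [a] as well. *)
Lemma levy_inequality (S : nat -> T -> R) (n : nat) (a : R) :
  (forall j, measurable_fun setT (S j)) ->
  (forall j, (j < n)%N -> forall A,
    <<s \bigcup_(i in [set i | (i <= j)%N]) sigma_rv (S i) >> A ->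
    (P A <= 2%:E * P (A `&` [set w | (S j w <= S n w)%R]))%E) ->
  (P [set w | exists2 j, (j <= n)%N & (a < S j w)%R]
    <= 2%:E * P [set w | (a < S n w)%R])%E.
Proof.
move=> mS SP.
pose F j := [set w | (a < S j w)%R].
have FE j : F j = S j @^-1` `]a, +oo[.
  by apply/seteqP; split => w; rewrite /F/= in_itv/= andbT.
have mF j : measurable (F j).
  by rewrite FE -[X in measurable X]setTI; exact: mS.
pose B j := [set w | (S j w <= S n w)%R].
have mB j : measurable (B j).
  by rewrite -[X in measurable X]setTI; exact: measurable_fun_le.
have FG j : <<s \bigcup_(i in [set i | (i <= j)%N]) sigma_rv (S i) >> (seqDU F j).
  pose G := \bigcup_(i in [set i | (i <= j)%N]) sigma_rv (S i).
  have h i : (i <= j)%N -> <<s G >> (F i).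
    move=> ij; apply: sub_gen_smallest; exists i => //.
    by exists `]a, +oo[%classic => //; rewrite setTI FE.
  apply: (@measurableD _ (g_sigma_algebraType G)); first exact: h.
  apply: (@bigsetU_measurable _ (g_sigma_algebraType G)) => i _.
  by apply: h; exact: ltnW.
have mD j : measurable (seqDU F j).
  apply: measurableD => //; exact: bigsetU_measurable.
have -> : [set w | exists2 j, (j <= n)%N & (a < S j w)%R] =
    \big[setU/set0]_(j < n.+1) seqDU F j.
  rewrite -bigsetU_seqDU -bigcup_mkord.
  by apply/seteqP; split => w [j jn Fj]; exists j.
rewrite measure_bigsetU//.
apply: (@le_trans _ _ (\sum_(j < n.+1) (2%:E * P (seqDU F j `&` B j)))%E).
  apply: lee_sum => j _; have := ltn_ord j; rewrite ltnS leq_eqVlt.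
  (* at the last index the walk is over, and the whole event counts *)
  move=> /orP[/eqP jn|jn]; last by apply: SP.
  have -> : seqDU F j `&` B j = seqDU F j.
    by apply/setIidl => w _; rewrite /B/= jn.
  by rewrite lee_pemull// lee_fin ler1n.
rewrite -ge0_sume_distrr; last by move=> j _; exact: measure_ge0.
rewrite lee_wpmul2l//.
have tDB : trivIset setT (fun j => seqDU F j `&` B j).
  by apply: trivIset_setIr; exact: trivIset_seqDU.
have mDB j : measurable (seqDU F j `&` B j) by exact: measurableI.
rewrite -(measure_bigsetU P mDB tDB).
apply: le_measure; rewrite ?inE; [exact: bigsetU_measurable|exact: mF|].
rewrite -(bigcup_mkord n.+1 (fun j => seqDU F j `&` B j)) => w [j jn [[Fj _] Bj]].
exact: lt_le_trans Bj.
Qed.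

End levy.

Section brownian.
Context d (T : measurableType d) (R : realType) (P : probability T R).
Variable W : R -> {RV P >-> R}.
Hypothesis hW : standard_brownian_motion W.

Lemma measurable_increment s t : measurable_fun setT (fun w => W t w - W s w).
Proof. by apply: measurable_funB. Qed.

(** The sign [(-1) ^+ e] treats a process and its reflection at once, and hence
    maxima and minima. *)
Lemma increment_tail (e : bool) (s t a : R) : s < t ->
  (P [set w | (a < (-1) ^+ e * (W t w - W s w))%R]
    <= (1 - Phi (a / Num.sqrt (t - s)))%:E)%E.
Proof.
move=> st; have r0 : 0 < Num.sqrt (t - s) by rewrite sqrtr_gt0 subr_gt0.
rewrite -normal_tailE//.
case: e.
  rewrite -normal_prob_opp ?gt_eqF// -(sbm_increments hW st)//.
  apply: le_measure; rewrite ?inE.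
  - by apply: measurable_gt; apply: measurable_funM => //; exact: measurable_increment.
  - by rewrite -[X in measurable X]setTI; apply: measurable_increment.
  - by move=> w /=; rewrite in_itv/= expr1 mulN1r; lra.
rewrite -(sbm_increments hW st)//.
apply: le_measure; rewrite ?inE.
- by apply: measurable_gt; apply: measurable_funM => //; exact: measurable_increment.
- by rewrite -[X in measurable X]setTI; apply: measurable_increment.
- by move=> w /=; rewrite in_itv/= expr0 mul1r andbT => /ltW.
Qed.

Lemma increment_half (e : bool) (s t : R) : s < t ->
  P [set w | (0 <= (-1) ^+ e * (W t w - W s w))%R] = (2^-1)%:E.
Proof.
move=> st; have r0 : Num.sqrt (t - s) != 0 by rewrite gt_eqF// sqrtr_gt0 subr_gt0.
rewrite -(normal_tail0 r0).
case: e.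
  rewrite -normal_prob_opp// -(sbm_increments hW st)//; congr (P _).
  apply/seteqP; split=> w /=; rewrite in_itv/= expr1 mulN1r oppr0; lra.
rewrite -(sbm_increments hW st)//; congr (P _).
by apply/seteqP; split=> w /=; rewrite in_itv/= expr0 mul1r andbT.
Qed.

Section grid.
Variables (n : nat) (t : nat -> R).
Hypothesis t_lt : forall i, (i < n)%N -> t i < t i.+1.

Definition grid_incr (i : nat) (w : T) : R := W (t i.+1) w - W (t i) w.

Definition grid_gen (J : set nat) : set_system T :=
  \bigcup_(i in [set i : 'I_n | J i]) sigma_rv (grid_incr i).

Lemma grid_ltn i j : (i < j)%N -> (j <= n)%N -> t i < t j.
Proof.
elim: j => // j IH; rewrite ltnS leq_eqVlt => /orP[/eqP ->|ij] jn.
  exact: t_lt.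
exact: lt_trans (IH ij (ltnW jn)) (t_lt jn).
Qed.

Lemma independent2_grid J1 J2 : J1 `&` J2 = set0 ->
  independent2 P <<s grid_gen J1 >> <<s grid_gen J2 >>.
Proof.
move=> J12; apply: independent2_blocks.
- by move=> i; apply: sigma_rv_measurable; exact: measurable_increment.
- by move=> i; exact: sigma_rvI.
- by move=> i; exact: sigma_rvT.
- exact: (sbm_independent hW).
- apply/seteqP; split => // i /= [J1i J2i].
  have : (J1 `&` J2) i by split.
  by rewrite J12.
Qed.

(** Telescoping: the increment from [t p] to [t q] is a sum of grid increments
    with indices in [J]. *)
Lemma measurable_grid_increment J p q : (p <= q)%N -> (q <= n)%N ->
  (forall i, (p <= i < q)%N -> J i) ->
  measurable_fun (setT : set (g_sigma_algebraType (grid_gen J)))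
    (fun w => W (t q) w - W (t p) w).
Proof.
elim: q => [|q IH].
  rewrite leqn0 => /eqP -> _ _.
  under eq_fun do rewrite subrr.
  exact: measurable_cst.
rewrite leq_eqVlt => /orP[/eqP -> _ _|].
  under eq_fun do rewrite subrr.
  exact: measurable_cst.
rewrite ltnS => pq qn Jpq.
have -> : (fun w => W (t q.+1) w - W (t p) w) =
    (fun w => grid_incr q w + (W (t q) w - W (t p) w)).
  by apply/funext => w; rewrite /grid_incr addrA subrK.
apply: measurable_funD.
  apply: measurable_fun_generate => A qA; exists (Ordinal qn) => //=.
  by apply: Jpq; rewrite pq/=.
apply: IH => //; first exact: ltnW.
move=> i /andP[pi iq]; apply: Jpq; rewrite pi/=; exact: ltnW.
Qed.

Lemma measure_le_half G1 G2 A B : independent2 P G1 G2 -> G1 A -> G2 B ->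
  P B = (2^-1)%:E -> (P A <= 2%:E * P (A `&` B))%E.
Proof.
move=> G12 GA GB PB; rewrite (G12 _ _ GA GB) PB muleCA -EFinM.
by rewrite divff// mule1.
Qed.

(** The walk up to [j] depends on the increments before [j], its continuation on
    those from [j] on; the continuation is symmetric. *)
Lemma levy_forward (e : bool) (a : R) : (0 < n)%N ->
  (P [set w | exists2 j, (j <= n)%N & (a < (-1) ^+ e * (W (t j) w - W (t 0) w))%R]
    <= 2%:E * (1 - Phi (a / Num.sqrt (t n - t 0)))%:E)%E.
Proof.
move=> n0.
pose S j w := (-1) ^+ e * (W (t j) w - W (t 0) w).
apply: (@le_trans _ _ (2%:E * P [set w | (a < S n w)%R])%E); last first.
  by rewrite lee_wpmul2l//; apply: increment_tail; exact: grid_ltn.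
apply: (levy_inequality (S := S)).
  by move=> j; apply: measurable_funM => //; exact: measurable_increment.
move=> j jn A SA.
have SE w : (S j w <= S n w) = (0 <= (-1) ^+ e * (W (t n) w - W (t j) w)).
  by rewrite -subr_ge0 /S -mulrBr opprB addrA subrK.
apply: (measure_le_half (@independent2_grid [set i | (i < j)%N]
  [set i | (j <= i)%N] _)).
- by apply/seteqP; split => // i /= [ij]; rewrite leqNgt ij.
- move: A SA; apply: smallest_sub.
    exact: (@sigma_algebra_measurable _ (g_sigma_algebraType _)).
  move=> A [i ij [B mB <-]]; rewrite setTI; apply: generate_preimage => //.
  apply: measurable_funM => //; apply: measurable_grid_increment => //.
    exact: leq_trans ij (ltnW jn).
  by move=> k /= ki; exact: leq_trans ki ij.
- rewrite (_ : [set w | _] =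
      (fun w => (-1) ^+ e * (W (t n) w - W (t j) w)) @^-1` `[0, +oo[); last first.
    by apply/seteqP; split => w /=; rewrite in_itv/= andbT SE.
  apply: generate_preimage => //.
  apply: measurable_funM => //; apply: measurable_grid_increment => //.
    exact: ltnW.
  by move=> k /= /andP[].
- rewrite -(increment_half e (grid_ltn jn (leqnn n))); congr (P _).
  by apply/seteqP; split => w /=; rewrite SE.
Qed.

(** The same with time reversed: the walk starts at [t n] and first meets the
    last increments. *)
Lemma levy_backward (e : bool) (a : R) : (0 < n)%N ->
  (P [set w | exists2 j, (j <= n)%N & (a < (-1) ^+ e * (W (t n) w - W (t (n - j)) w))%R]
    <= 2%:E * (1 - Phi (a / Num.sqrt (t n - t 0)))%:E)%E.
Proof.
move=> n0.
pose S j w := (-1) ^+ e * (W (t n) w - W (t (n - j)) w).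
apply: (@le_trans _ _ (2%:E * P [set w | (a < S n w)%R])%E); last first.
  by rewrite lee_wpmul2l// /S subnn; apply: increment_tail; exact: grid_ltn.
apply: (levy_inequality (S := S)).
  by move=> j; apply: measurable_funM => //; exact: measurable_increment.
move=> j jn A SA.
have nj0 : (0 < n - j)%N by rewrite subn_gt0.
have SE w : (S j w <= S n w) = (0 <= (-1) ^+ e * (W (t (n - j)) w - W (t 0) w)).
  rewrite -subr_ge0 /S subnn -mulrBr opprB addrC addrA subrK.
  by rewrite addrC.
apply: (measure_le_half (@independent2_grid [set i | (n - j <= i)%N]
  [set i | (i < n - j)%N] _)).
- by apply/seteqP; split => // i /= [ij]; rewrite ltnNge ij.
- move: A SA; apply: smallest_sub.
    exact: (@sigma_algebra_measurable _ (g_sigma_algebraType _)).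
  move=> A [i ij [B mB <-]]; rewrite setTI; apply: generate_preimage => //.
  apply: measurable_funM => //; apply: measurable_grid_increment => //.
    exact: leq_subr.
  by move=> k /= /andP[+ _]; apply: leq_trans; exact: leq_sub2l.
- rewrite (_ : [set w | _] =
      (fun w => (-1) ^+ e * (W (t (n - j)) w - W (t 0) w)) @^-1` `[0, +oo[); last first.
    by apply/seteqP; split => w /=; rewrite in_itv/= andbT SE.
  apply: generate_preimage => //.
  apply: measurable_funM => //; apply: measurable_grid_increment => //.
  exact: leq_subr.
- rewrite -(increment_half e (grid_ltn nj0 (leq_subr _ _))); congr (P _).
  by apply/seteqP; split => w /=; rewrite SE.
Qed.

End grid.

Section dyadic.
Variable b : R.
Hypothesis b0 : 0 < b.

Definition dyadic (m j : nat) : R := b * (j%:R / 2 ^+ m).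

Let pow0 m : 0 < 2 ^+ m :> R. Proof. exact: exprn_gt0. Qed.
Let powE m : (2 ^ m)%N%:R = 2 ^+ m :> R. Proof. by rewrite natrX. Qed.
Let powN0 m : 2 ^+ m != 0 :> R. Proof. by rewrite gt_eqF. Qed.

Lemma dyadic0 m : dyadic m 0 = 0.
Proof. by rewrite /dyadic mul0r mulr0. Qed.

Lemma dyadic_end m : dyadic m (2 ^ m) = b.
Proof. by rewrite /dyadic powE divff// mulr1. Qed.

Lemma dyadic_ltS m j : dyadic m j < dyadic m j.+1.
Proof. by rewrite /dyadic ltr_pM2l// ltr_pM2r ?invr_gt0// ltr_nat. Qed.

Lemma dyadic_double m j : dyadic m.+1 j.*2 = dyadic m j.
Proof.
rewrite /dyadic -muln2 natrM exprS; congr (_ * _).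
by field; exact: powN0.
Qed.

Lemma dyadic_ge0 m j : 0 <= dyadic m j.
Proof. by rewrite /dyadic !mulr_ge0 ?invr_ge0// ltW. Qed.

Lemma dyadic_le m j : (j <= 2 ^ m)%N -> dyadic m j <= b.
Proof.
move=> jm; rewrite /dyadic ler_piMr ?(ltW b0)// ler_pdivrMr// mul1r -powE.
by rewrite ler_nat.
Qed.

Lemma dyadic_opp m j : (j <= 2 ^ m)%N -> dyadic m (2 ^ m - j) - b = - dyadic m j.
Proof.
move=> jm; rewrite /dyadic natrB// powE; field; exact: powN0.
Qed.

Lemma dyadic_shift m j : dyadic m (2 ^ m + j) - b = dyadic m j.
Proof.
rewrite /dyadic natrD powE; field; exact: powN0.
Qed.

(** [f] stays above [a] near [t], and the dyadic point just below [t] is within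
    [b / 2 ^+ m] of it. *)
Lemma dyadic_dense (f : R -> R) (t a : R) : {for t, continuous f} ->
  0 <= t <= b -> a < f t ->
  exists m j, (j <= 2 ^ m)%N /\ a < f (dyadic m j).
Proof.
move=> cf /andP[t0 tb] aft.
have : \forall y \near t, a < f y by exact: (cvgr_gt _ cf).
move=> /nbhs_ballP[r /= r0 tr].
have [m bm] : exists m, b / 2 ^+ m < r.
  pose m := (Num.truncn (b / r)).+1; exists m.
  rewrite ltr_pdivrMr// mulrC -ltr_pdivrMr//.
  apply: (@lt_trans _ _ m%:R); first exact: Num.Theory.truncnS_gt.
  by rewrite -powE ltr_nat ltn_expl.
pose j := Num.truncn (t / b * 2 ^+ m).
have tb0 : 0 <= t / b * 2 ^+ m by rewrite mulr_ge0 ?divr_ge0// ltW.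
have /andP[j1 j2] := truncn_itv tb0.
exists m, j; split.
  rewrite -(ler_nat R) powE (le_trans j1)// ler_piMl ?(ltW (pow0 m))//.
  by rewrite ler_pdivrMr// mul1r.
apply: tr; rewrite /ball/= /dyadic.
(* in units of the mesh, the distance to the grid is a fractional part *)
have -> : t - b * (j%:R / 2 ^+ m) = (t / b * 2 ^+ m - j%:R) * (b / 2 ^+ m).
  by field; rewrite powN0 gt_eqF.
rewrite ger0_norm; last first.
  by rewrite mulr_ge0 ?subr_ge0// divr_ge0// ltW.
apply: le_lt_trans bm; rewrite ler_piMl ?divr_ge0 ?(ltW b0)//.
by rewrite lerBlDl natr1 ltW.
Qed.

(** The signs [e] and [s] reflect space and time: they select the maximum or the
    minimum, on the positive or on the negative half of [[- b, b]]. *)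
Definition side_exceeds (e s : bool) (a : R) : set T :=
  [set w | exists2 t, t \in `[0, b] & a < (-1) ^+ e * W ((-1) ^+ s * t) w].

Definition side_exceeds_at (e s : bool) (a : R) (m : nat) : set T :=
  [set w | exists2 j, (j <= 2 ^ m)%N &
    a < (-1) ^+ e * W ((-1) ^+ s * dyadic m j) w].

Lemma W0 w : W 0 w = 0.
Proof. exact: (sbm_start hW). Qed.

Lemma measurable_side_exceeds_at e s a m :
  measurable (side_exceeds_at e s a m).
Proof.
have -> : side_exceeds_at e s a m = \bigcup_(j in [set j | (j <= 2 ^ m)%N])
    [set w | a < (-1) ^+ e * W ((-1) ^+ s * dyadic m j) w].
  by apply/seteqP; split => w [j jm h]; exists j.
apply: bigcup_measurable => j _; apply: measurable_gt.
exact: measurable_funM.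
Qed.

Lemma side_exceedsE e s a :
  side_exceeds e s a = \bigcup_m side_exceeds_at e s a m.
Proof.
apply/seteqP; split => w.
  move=> [t]; rewrite in_itv/= => tb at_.
  have cf : {for t, continuous (fun t : R => (-1) ^+ e * W ((-1) ^+ s * t) w)}.
    apply: cvgM; first exact: cvg_cst.
    apply: (@continuous_comp _ _ _ (fun t : R => (-1) ^+ s * t) (fun t : R => W t w)).
      by apply: cvgM; [exact: cvg_cst|exact: cvg_id].
    exact: (sbm_continuous hW).
  have [m [j [jm h]]] := dyadic_dense cf tb at_.
  by exists m => //; exists j.
move=> [m _ [j jm h]]; exists (dyadic m j) => //.
by rewrite in_itv/= dyadic_ge0 dyadic_le.
Qed.

Lemma measurable_side_exceeds e s a : measurable (side_exceeds e s a).
Proof.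
rewrite side_exceedsE; apply: bigcup_measurable => m _.
exact: measurable_side_exceeds_at.
Qed.

Lemma side_exceeds_at_nondecreasing e s a :
  nondecreasing_seq (side_exceeds_at e s a).
Proof.
apply/nondecreasing_seqP => m; apply/subsetPset => w [j jm h].
exists j.*2; first by rewrite expnS mul2n leq_double.
by rewrite dyadic_double.
Qed.

Lemma side_exceeds_at_tail e s a m :
  (P (side_exceeds_at e s a m) <= 2%:E * (1 - Phi (a / Num.sqrt b))%:E)%E.
Proof.
have m0 : (0 < 2 ^ m)%N by rewrite expn_gt0.
case: s.
- have lt i : (i < 2 ^ m)%N -> dyadic m i - b < dyadic m i.+1 - b.
    by move=> _; rewrite ltrD2r dyadic_ltS.
  have := levy_backward lt (~~ e) a m0.
  rewrite dyadic0 dyadic_end sub0r opprK subrr add0r; apply: le_trans.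
  rewrite le_eqVlt; apply/orP; left; apply/eqP; congr (P _).
  apply/seteqP; split => w [j jm h]; exists j => //; move: h.
    by rewrite W0 dyadic_opp// sub0r expr1 mulN1r signrN mulrNN.
  by rewrite W0 dyadic_opp// sub0r expr1 mulN1r signrN mulrNN.
- have lt i : (i < 2 ^ m)%N -> dyadic m i < dyadic m i.+1.
    by move=> _; exact: dyadic_ltS.
  have := levy_forward lt e a m0.
  rewrite dyadic0 dyadic_end subr0; apply: le_trans.
  rewrite le_eqVlt; apply/orP; left; apply/eqP; congr (P _).
  apply/seteqP; split => w [j jm h]; exists j => //; move: h.
    by rewrite W0 subr0 expr0 mul1r.
  by rewrite W0 subr0 expr0 mul1r.
Qed.

(** The dyadic grids are nested, so the estimate on the grids passes to their
    union. *)
Lemma side_exceeds_tail e s a :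
  (P (side_exceeds e s a) <= 2%:E * (1 - Phi (a / Num.sqrt b))%:E)%E.
Proof.
rewrite side_exceedsE; apply: nondecreasing_bigcup_measure_le.
- exact: measurable_side_exceeds_at.
- exact: side_exceeds_at_nondecreasing.
- exact: side_exceeds_at_tail.
Qed.

Lemma side_exceeds_at_grid (e s : bool) (a : R) (m : nat) :
  <<s grid_gen (2 ^ m + 2 ^ m) (fun j => dyadic m j - b)
    (if s then [set i | (i < 2 ^ m)%N] else [set i | (2 ^ m <= i)%N]) >>
  (side_exceeds_at e s a m).
Proof.
have -> : side_exceeds_at e s a m = \bigcup_(j in [set j | (j <= 2 ^ m)%N])
    [set w | a < (-1) ^+ e * W ((-1) ^+ s * dyadic m j) w].
  by apply/seteqP; split => w [j jm h]; exists j.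
apply: (@bigcup_measurable _ (g_sigma_algebraType _)) => j jm.
case: s.
- have -> : [set w | a < (-1) ^+ e * W ((-1) ^+ true * dyadic m j) w] =
      [set w | a < (-1) ^+ e * (-1 *
        (W (dyadic m (2 ^ m) - b) w - W (dyadic m (2 ^ m - j) - b) w))].
    apply/funext => w /=; rewrite dyadic_end subrr W0 dyadic_opp// sub0r.
    by rewrite mulN1r opprK expr1 mulN1r.
  apply: (@measurable_gt _ (g_sigma_algebraType _)).
  do 2 (apply: measurable_funM; first exact: measurable_cst).
  apply: measurable_grid_increment; [exact: leq_subr|exact: leq_addr|].
  by move=> i /= /andP[].
- have -> : [set w | a < (-1) ^+ e * W ((-1) ^+ false * dyadic m j) w] =
      [set w | a < (-1) ^+ e *
        (W (dyadic m (2 ^ m + j) - b) w - W (dyadic m (2 ^ m) - b) w)].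
    apply/funext => w /=; rewrite dyadic_end subrr W0 dyadic_shift subr0.
    by rewrite expr0 mul1r.
  apply: (@measurable_gt _ (g_sigma_algebraType _)).
  apply: measurable_funM; first exact: measurable_cst.
  apply: measurable_grid_increment; [exact: leq_addr|by rewrite leq_add2l|].
  by move=> i /= /andP[].
Qed.

(** The two halves depend on disjoint sets of increments of one grid on
    [[- b, b]]. *)
Lemma independent_sides_at e a m :
  P (~` side_exceeds_at e false a m `&` ~` side_exceeds_at e true a m) =
  (P (~` side_exceeds_at e false a m) * P (~` side_exceeds_at e true a m))%E.
Proof.
have lt i : (i < 2 ^ m + 2 ^ m)%N -> dyadic m i - b < dyadic m i.+1 - b.
  by move=> _; rewrite ltrD2r dyadic_ltS.
apply: (independent2_grid lt (J1 := [set i | (2 ^ m <= i)%N])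
  (J2 := [set i | (i < 2 ^ m)%N])).
- by apply/seteqP; split => // i /= [ij]; rewrite ltnNge ij.
- have h := @side_exceeds_at_grid e false a m.
  exact: (@measurableC _ (g_sigma_algebraType _) _ h).
- have h := @side_exceeds_at_grid e true a m.
  exact: (@measurableC _ (g_sigma_algebraType _) _ h).
Qed.

(** Not exceeding [a] on the interval means not exceeding it on either half.
    These events are independent, and each has probability at least
    [2 * Phi (a / sqrt b) - 1], a nonnegative number because [a >= 0]. *)
Lemma two_sides_exceed e a : 0 <= a ->
  (P (side_exceeds e false a `|` side_exceeds e true a)
    <= (1 - (2 * Phi (a / Num.sqrt b) - 1) ^+ 2)%:E)%E.
Proof.
move=> a0.
have p0 : 0 <= 2 * Phi (a / Num.sqrt b) - 1.
  have : 2^-1 <= Phi (a / Num.sqrt b).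
    by apply: Phi_ge_half; rewrite divr_ge0// sqrtr_ge0.
  lra.
rewrite !side_exceedsE -bigcupU; apply: nondecreasing_bigcup_measure_le.
- by move=> m; apply: measurableU; exact: measurable_side_exceeds_at.
- move=> m n mn; apply/subsetPset; apply: setUSS; apply/subsetPset;
  exact: side_exceeds_at_nondecreasing.
move=> m.
have mU : measurable (side_exceeds_at e false a m `|` side_exceeds_at e true a m).
  by apply: measurableU; exact: measurable_side_exceeds_at.
suff : (P (side_exceeds_at e false a m `|` side_exceeds_at e true a m)
    <= (1 - (2 * Phi (a / Num.sqrt b) - 1) ^+ 2)%:E)%E by [].
rewrite -[X in P X]setCK probability_setC; last exact: measurableC.
rewrite setCU independent_sides_at EFinB leeB// expr2 EFinM.
have h s : ((2 * Phi (a / Num.sqrt b) - 1)%:E <= P (~` side_exceeds_at e s a m))%E.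
  rewrite probability_setC; last exact: measurable_side_exceeds_at.
  have -> : (2 * Phi (a / Num.sqrt b) - 1 = 1 - 2 * (1 - Phi (a / Num.sqrt b))) by ring.
  rewrite EFinB leeB// EFinM; exact: side_exceeds_at_tail.
by apply: lee_pmul.
Qed.

End dyadic.

End brownian.

(** * Suprema of paths and blocks of paths *)

Section path_supremum.
Context (R : realType) (b : R).
Hypothesis b0 : 0 < b.

Definition path_sup (f : R -> R) : R := sup [set f t | t in `[- b, b]].

Lemma path_sup_gtP (f : R -> R) (r : R) : continuous f ->
  r < path_sup f <-> exists2 t, t \in `[- b, b] & r < f t.
Proof.
move=> cf.
have bb : - b <= b by have := b0; lra.
have ne : [set f t | t in `[- b, b]] !=set0.
  by exists (f b), b => //=; rewrite in_itv/= lexx bb.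
split.
  by move=> /(sup_gt ne)[_ [t tb <-] rt]; exists t.
move=> [t tb rt]; apply: (lt_le_trans rt); apply: ub_le_sup; last by exists t.
have [s _ fs] := EVT_max bb (continuous_subspaceT cf).
by exists (f s) => _ [u ub <-]; exact: fs.
Qed.

Lemma path_sup_ge (f : R -> R) t : continuous f -> t \in `[- b, b] ->
  f t <= path_sup f.
Proof.
move=> cf tb; rewrite leNgt; apply/negP => h.
have : path_sup f < path_sup f by apply/(path_sup_gtP _ cf); exists t.
by rewrite ltxx.
Qed.

(** Countably many times decide the supremum, which makes it measurable. *)
Lemma path_sup_gt_dyadic (f : R -> R) (r : R) : continuous f ->
  r < path_sup f <-> exists m j (s : bool), (j <= 2 ^ m)%N /\
    r < f ((-1) ^+ s * dyadic b m j).
Proof.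
move=> cf; rewrite path_sup_gtP//; split.
  move=> [t]; rewrite in_itv/= => /andP[tb1 tb2] rt.
  pose s := t < 0.
  have tE : t = (-1) ^+ s * `|t|.
    rewrite /s; have [t0|t0] := ltP t 0.
      by rewrite expr1 ltr0_norm// mulN1r opprK.
    by rewrite expr0 mul1r ger0_norm.
  have cg : {for `|t|, continuous (fun t : R => f ((-1) ^+ s * t))}.
    apply: (@continuous_comp _ _ _ (fun t : R => (-1) ^+ s * t) f); last exact: cf.
    by apply: cvgM; [exact: cvg_cst|exact: cvg_id].
  have tb : 0 <= `|t| <= b by rewrite normr_ge0 ler_norml tb1.
  rewrite tE in rt.
  have [m [j [jm h]]] := dyadic_dense b0 cg tb rt.
  by exists m, j, s.
move=> [m [j [s [jm h]]]]; exists ((-1) ^+ s * dyadic b m j) => //.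
have := dyadic_ge0 b0 m j; have := dyadic_le b0 jm.
by rewrite in_itv/=; case: s {h}; rewrite ?expr1 ?expr0; lra.
Qed.

Lemma measurable_path_sup d (T : measurableType d) (V : R -> T -> R) :
  (forall t, measurable_fun setT (V t)) ->
  (forall w, continuous (fun t => V t w)) ->
  measurable_fun setT (fun w => path_sup (fun t => V t w)).
Proof.
move=> mV cV; apply: (measurability _ (RGenOInfty.measurableE R)) => //.
move=> _ [_ [r ->] <-]; rewrite setTI.
rewrite (_ : _ @^-1` _ = \bigcup_m \bigcup_(j in [set j | (j <= 2 ^ m)%N])
  \bigcup_(s in [set: bool]) [set w | r < V ((-1) ^+ s * dyadic b m j) w]).
  apply: bigcup_measurable => m _; apply: bigcup_measurable => j _.
  apply: fin_bigcup_measurable; first exact: finite_finset.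
  by move=> s _; exact: measurable_gt.
apply/seteqP; split=> w /=; rewrite in_itv/= andbT.
  move=> /(path_sup_gt_dyadic _ (cV w))[m [j [s [jm h]]]].
  by exists m => //; exists j => //; exists s.
move=> [m _ [j jm [s _ h]]]; apply/(path_sup_gt_dyadic _ (cV w)).
by exists m, j, s.
Qed.

End path_supremum.

(** The default value of the maximum varies with the argument and is not a
    neutral element, so monoid lemmas do not apply; the induction peels off the
    first term. *)
Lemma bigmax_closed (R : realType) (X : Type) (K : (X -> R) -> Prop)
    (f0 : X -> R) (f : nat -> X -> R) (k : nat) :
  (forall g h, K g -> K h -> K (fun w => Num.max (g w) (h w))) -> K f0 ->
  (forall i, (i < k)%N -> K (f i)) ->
  K (fun w => \big[Num.max/f0 w]_(i < k) f i w).
Proof.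
move=> Kmax K0; elim: k f => [|k IH] f Kf.
  by under eq_fun do rewrite big_ord0.
under eq_fun do rewrite big_ord_recl.
apply: Kmax; first exact: (Kf 0).
by apply: (IH (fun i => f i.+1)) => i ik; exact: Kf.
Qed.

(** For [z <= 0] both sides vanish, as [ln] does. *)
Lemma ln_div1 (R : realType) (z : R) : ln (1 / z) = - ln z.
Proof.
rewrite div1r; have [z0|z0] := ltP 0 z; first by rewrite lnV.
by rewrite !ln0 ?oppr0// invr_le0.
Qed.

Section first_paths.
Context (R : realType) d (T : measurableType d) (b : R).
Hypothesis b0 : 0 < b.
Variables (y : nat -> T -> R) (v : nat -> R -> T -> R).

(** These are the arrivals, paths and maxima of the model, for plain functions
    on an arbitrary measurable space.  The generality pays off when the same
    sample space carries a smaller sigma-algebra: measurability there locates an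
    event in the information of the first [k] paths. *)
Definition log_inv_sum (k : nat) (w : T) : R := ln (1 / \sum_(l < k) y l w).

Definition tilted_path (i : nat) (t : R) (w : T) : R :=
  log_inv_sum i.+1 w + v i t w - `|t| / 2.

Definition path_max (k : nat) (t : R) (w : T) : R :=
  \big[Num.max/tilted_path 0 t w]_(i < k) tilted_path i t w.

Hypothesis cv : forall i w, continuous (fun t => v i t w).

Lemma continuous_tilted_path i w : continuous (fun t => tilted_path i t w).
Proof.
move=> t; apply: cvgB; first by apply: cvgD; [exact: cvg_cst|exact: cv].
by apply: cvgM; [exact: norm_continuous|exact: cvg_cst].
Qed.

Lemma continuous_path_max k w : continuous (fun t => path_max k t w).
Proof.
apply: (@bigmax_closed R R (fun g : R -> R => continuous g) (fun t => tilted_path 0 t w)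
  (fun i t => tilted_path i t w) k).
- by move=> g h cg ch t; apply: continuous_max; [exact: cg|exact: ch].
- exact: continuous_tilted_path.
- by move=> i _; exact: continuous_tilted_path.
Qed.

Lemma measurable_log_inv_sum k :
  (forall l, (l < k)%N -> measurable_fun setT (y l)) ->
  measurable_fun setT (log_inv_sum k).
Proof.
move=> my; rewrite /log_inv_sum; under eq_fun do rewrite ln_div1.
apply: measurableT_comp => //; apply: measurableT_comp.
  exact: measurable_ln.
have -> : (fun w => \sum_(l < k) y l w) =
    (fun w => \sum_(l < k) (if (l < k)%N then y l w else 0)).
  by apply/funext => w; apply: eq_bigr => l _; rewrite ltn_ord.
apply: measurable_sum => l; case: (ltnP l k) => // lk; exact: my.
Qed.

Lemma measurable_tilted_path i t :
  (forall l, (l <= i)%N -> measurable_fun setT (y l)) ->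
  measurable_fun setT (v i t) -> measurable_fun setT (tilted_path i t).
Proof.
move=> my mv; apply: measurable_funB => //; apply: measurable_funD => //.
exact: measurable_log_inv_sum.
Qed.

Lemma measurable_path_max k t : (0 < k)%N ->
  (forall l, (l < k)%N -> measurable_fun setT (y l)) ->
  (forall l, (l < k)%N -> measurable_fun setT (v l t)) ->
  measurable_fun setT (path_max k t).
Proof.
move=> k0 my mv.
have mt i : (i < k)%N -> measurable_fun setT (tilted_path i t).
  move=> ik; apply: measurable_tilted_path; last exact: mv.
  by move=> l li; apply: my; exact: leq_ltn_trans ik.
apply: (@bigmax_closed R T (measurable_fun setT) (tilted_path 0 t)
  (fun i => tilted_path i t) k) => //.
- by move=> g h mg mh; exact: measurable_maxr.
- exact: mt.
Qed.

Lemma measurable_inf_path_max k : (0 < k)%N ->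
  (forall l, (l < k)%N -> measurable_fun setT (y l)) ->
  (forall l t, (l < k)%N -> measurable_fun setT (v l t)) ->
  measurable_fun setT
    (fun w => inf [set path_max k t w + `|t| / 2 | t in `[- b, b]]).
Proof.
move=> k0 my mv.
have -> : (fun w => inf [set path_max k t w + `|t| / 2 | t in `[- b, b]]) =
    (fun w => - path_sup b (fun t => - (path_max k t w + `|t| / 2))).
  apply/funext => w; rewrite /inf /path_sup; congr (- sup _).
  by rewrite image_comp.
apply: measurableT_comp => //; apply: measurable_path_sup => //.
  move=> t; apply: measurableT_comp => //; apply: measurable_funD => //.
  by apply: measurable_path_max => // l; exact: mv.
move=> w t; apply: cvgN; apply: cvgD; first exact: continuous_path_max.
by apply: cvgM; [exact: norm_continuous|exact: cvg_cst].
Qed.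

Lemma measurable_path_overtakes k i : (0 < k)%N ->
  (forall l, measurable_fun setT (y l)) ->
  (forall l t, measurable_fun setT (v l t)) ->
  measurable [set w | exists2 t, t \in `[- b, b] &
    path_max k t w < tilted_path i t w].
Proof.
move=> k0 my mv.
pose f w := path_sup b (fun t => tilted_path i t w - path_max k t w).
have cf w : continuous (fun t => tilted_path i t w - path_max k t w).
  by move=> t; apply: cvgB; [exact: continuous_tilted_path|exact: continuous_path_max].
have -> : [set w | exists2 t, t \in `[- b, b] &
    path_max k t w < tilted_path i t w] = [set w | 0 < f w].
  apply/seteqP; split=> w /=.
    move=> [t tb h]; apply/(path_sup_gtP b0 _ (cf w)).
    by exists t => //; rewrite subr_gt0.
  move=> /(path_sup_gtP b0 _ (cf w))[t tb h]; exists t => //.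
  by rewrite -subr_gt0.
apply: measurable_gt; apply: measurable_path_sup => // t.
apply: measurable_funB; first exact: measurable_tilted_path.
exact: measurable_path_max.
Qed.

End first_paths.

Section joint_blocks.
Context d (T : measurableType d) (R : realType) (P : probability T R).
Variables (Y : nat -> {RV P >-> R}) (W : nat -> R -> {RV P >-> R}).
Hypothesis hYW : brown_resnick_input Y W.

Definition path_sigma (i : nat) : set_system T :=
  sigma_process (fun (t : R) (w : T) => W i t w).

Definition path_block (J : set nat) : set_system T :=
  <<s \bigcup_(i in J) path_sigma i >>.

(** Events decided by the exponential variables and the paths of a block, as
    intersections of one event of each kind; they form a pi-system. *)
Definition rectangles (J : set nat) : set_system T :=
  [set C | exists A B, [/\ sigma_block Y J A, path_block J B & C = A `&` B]].

Let YT J : sigma_block Y J setT.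
Proof. exact: (@measurableT _ (g_sigma_algebraType _)). Qed.

Let WT J : path_block J setT.
Proof. exact: (@measurableT _ (g_sigma_algebraType _)). Qed.

Lemma sigma_block_sub J : sigma_block Y J `<=` sigma_process (fun i w => Y i w).
Proof. by apply: sub_sigma_algebra2 => A [i _ YA]; exists i. Qed.

Lemma path_block_sub J : path_block J `<=`
  sigma_process (fun (it : nat * R) (w : T) => W it.1 it.2 w).
Proof.
apply: smallest_sub.
  exact: (@sigma_algebra_measurable _ (g_sigma_algebraType _)).
move=> A [i _]; apply: sub_sigma_algebra2 => B [t _ WB].
by exists (i, t).
Qed.

Lemma path_sigma_measurable i : path_sigma i `<=` measurable.
Proof. by apply: sigma_process_le => t. Qed.

Lemma sigma_block_measurable J : sigma_block Y J `<=` measurable.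
Proof.
by apply: sub_generate_measurable => A [i _]; apply: sigma_rv_measurable.
Qed.

Lemma path_block_measurable J : path_block J `<=` measurable.
Proof.
by apply: sub_generate_measurable => A [i _]; exact: path_sigma_measurable.
Qed.

Lemma independent2_path_block J1 J2 : J1 `&` J2 = set0 ->
  independent2 P (path_block J1) (path_block J2).
Proof.
move=> J12; apply: independent2_blocks => //.
- exact: path_sigma_measurable.
- by move=> i; exact: sigma_processI.
- by move=> i; exact: sigma_processT.
- exact: (W_independent hYW).
Qed.

(** The exponential variables are independent of the paths, and within either
    family disjoint blocks are independent: the product rule factors four
    ways. *)
Lemma independent2_rectangles J1 J2 : J1 `&` J2 = set0 ->
  independent2 P <<s rectangles J1 >> <<s rectangles J2 >>.
Proof.
move=> J12.
have mr J : rectangles J `<=` measurable.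
  move=> _ [A [B [YA WB ->]]]; apply: measurableI.
    exact: sigma_block_measurable YA.
  exact: path_block_measurable WB.
have rI J : setI_closed (rectangles J).
  move=> _ _ [A1 [B1 [YA1 WB1 ->]]] [A2 [B2 [YA2 WB2 ->]]].
  exists (A1 `&` A2), (B1 `&` B2); rewrite setIACA; split => //.
    exact: (@measurableI _ (g_sigma_algebraType _)).
  exact: (@measurableI _ (g_sigma_algebraType _)).
have rT J : rectangles J setT.
  by exists setT, setT; rewrite setIT.
apply: independent2_generate => //.
move=> _ _ [A1 [B1 [YA1 WB1 ->]]] [A2 [B2 [YA2 WB2 ->]]].
have YW := YW_independent hYW.
rewrite setIACA (YW (A1 `&` A2)); last 2 first.
- apply: (@measurableI _ (g_sigma_algebraType _)).
    exact: sigma_block_sub YA1.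
  exact: sigma_block_sub YA2.
- apply: (@measurableI _ (g_sigma_algebraType _)).
    exact: path_block_sub WB1.
  exact: path_block_sub WB2.
rewrite (independent2_sigma_block (Y_independent hYW) J12 YA1 YA2).
rewrite (independent2_path_block J12 WB1 WB2).
rewrite (YW _ _ (sigma_block_sub YA1) (path_block_sub WB1)).
rewrite (YW _ _ (sigma_block_sub YA2) (path_block_sub WB2)).
by rewrite muleACA.
Qed.

Lemma sigma_block_rectangles J : sigma_block Y J `<=` <<s rectangles J >>.
Proof.
by move=> A YA; apply: sub_gen_smallest; exists A, setT; rewrite setIT.
Qed.

Lemma path_block_rectangles J : path_block J `<=` <<s rectangles J >>.
Proof.
by move=> A WA; apply: sub_gen_smallest; exists setT, A; rewrite setTI.
Qed.

Lemma measurable_Y_rectangles J i : J i ->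
  measurable_fun (setT : set (g_sigma_algebraType (rectangles J))) (Y i).
Proof.
move=> Ji _ A mA; rewrite setTI; apply: sigma_block_rectangles.
apply: sub_gen_smallest; exists i => //; exists A => //; rewrite setTI//.
Qed.

Lemma measurable_W_rectangles J i t : J i ->
  measurable_fun (setT : set (g_sigma_algebraType (rectangles J))) (W i t).
Proof.
move=> Ji _ A mA; rewrite setTI; apply: path_block_rectangles.
apply: sub_gen_smallest; exists i => //; apply: sub_gen_smallest.
by exists t => //; exists A => //; rewrite setTI.
Qed.

End joint_blocks.

(** * The error bounds *)

Section brownian_supremum.
Context d (T : measurableType d) (R : realType) (P : probability T R).
Variables (W : R -> {RV P >-> R}) (b : R).
Hypothesis hW : standard_brownian_motion W.
Hypothesis b0 : 0 < b.

Lemma measurable_brownian_sup :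
  measurable_fun setT (fun w => path_sup b (fun t => W t w)).
Proof.
by apply: measurable_path_sup => // w; exact: (sbm_continuous hW).
Qed.

Lemma continuous_signed (e : bool) w :
  continuous (fun t => (-1) ^+ e * W t w).
Proof.
by move=> t; apply: cvgM; [exact: cvg_cst|exact: (sbm_continuous hW)].
Qed.

Lemma two_sides_exceedE (e : bool) (a : R) :
  side_exceeds W b e false a `|` side_exceeds W b e true a =
  [set w | a < path_sup b (fun t => (-1) ^+ e * W t w)].
Proof.
apply/seteqP; split => w /=.
  move=> [] [t]; rewrite in_itv/= => /andP[t0 tb] h;
    apply/(path_sup_gtP b0 _ (@continuous_signed e w)).
    by exists t; [rewrite in_itv/=; have := b0; lra|rewrite expr0 mul1r in h].
  by exists (- t); [rewrite in_itv/=; have := b0; lra|rewrite expr1 mulN1r in h].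
move=> /(path_sup_gtP b0 _ (@continuous_signed e w))[t].
rewrite in_itv/= => /andP[tb1 tb2] h.
have [t0|t0] := leP 0 t; [left|right].
  by exists t; rewrite ?in_itv/= ?t0// expr0 mul1r.
exists (- t); first by rewrite in_itv/=; lra.
by rewrite expr1 mulN1r opprK.
Qed.

(** A union bound over the two halves of the interval, with a factor 2 from
    Levy's inequality on each. *)
Lemma brownian_sup_tail (r : R) :
  (P [set w | (r < path_sup b (fun t => W t w))%R]
    <= (4 * (1 - Phi (r / Num.sqrt b)))%:E)%E.
Proof.
have -> : [set w | r < path_sup b (fun t => W t w)] =
    side_exceeds W b false false r `|` side_exceeds W b false true r.
  rewrite two_sides_exceedE; apply/funext => w /=.
  by under [in RHS]eq_fun do rewrite expr0 mul1r.
have mA s : measurable (side_exceeds W b false s r) by exact: measurable_side_exceeds.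
apply: (le_trans (measureU2 _ (mA false) (mA true))).
have -> : (4 * (1 - Phi (r / Num.sqrt b)))%:E =
    (2%:E * (1 - Phi (r / Num.sqrt b))%:E + 2%:E * (1 - Phi (r / Num.sqrt b))%:E)%E.
  by rewrite -!EFinM -EFinD; congr EFin; ring.
by apply: leeD; exact: side_exceeds_tail.
Qed.

End brownian_supremum.

Section main.
Context d (T : measurableType d) (R : realType) (P : probability T R).
Variables (Y : nat -> {RV P >-> R}) (W : nat -> R -> {RV P >-> R}).
Hypothesis hYW : brown_resnick_input Y W.
Variable b : R.
Hypothesis b0 : 0 < b.

Let Yexp := Y_exponential hYW.
Let Yind := Y_independent hYW.

(** If the sum is not positive, then [log_arrival] is 0 and both sides hold. *)
Lemma lt_log_arrival (x : R) k w : x < 0 ->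
  (x < log_arrival Y k w) = (block_sum Y 0 k w < expR (- x)).
Proof.
move=> x0; rewrite /log_arrival ln_div1 -/(block_sum Y 0 k w).
set S := block_sum Y 0 k w; have [S0|S0] := ltP 0 S.
  by rewrite ltrNr -[LHS]ltr_expR lnK.
by rewrite ln0// oppr0 x0 (le_lt_trans S0)// expR_gt0.
Qed.

Lemma log_arrival_tail (x : R) k : (0 < k)%N -> x < 0 ->
  (P [set w | (x < log_arrival Y k w)%R] <= (bound_log_arrival k x)%:E)%E.
Proof.
case: k => // k _ x0.
have -> : [set w | (x < log_arrival Y k.+1 w)%R] =
    [set w | (block_sum Y 0 k.+1 w < expR (- x))%R].
  by apply/seteqP; split=> w /=; rewrite lt_log_arrival.
apply: (le_trans (prob_block_sumS_lt Yexp Yind k (expR_gt0 _))).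
by rewrite /bound_log_arrival /= -mulrN expRM_natl.
Qed.

Lemma measurable_inf_first k : (0 < k)%N ->
  measurable_fun setT (inf_first Y W b k).
Proof.
move=> k0.
apply: (@measurable_inf_path_max R _ T b b0 (fun i w => Y i w)
  (fun i t w => W i t w)) => //.
by move=> i w; exact: (sbm_continuous (W_brownian hYW i)).
Qed.

Lemma Z_first_ge k i t w : (i < k)%N -> BR_path Y W i t w <= Z_first Y W k t w.
Proof.
move=> ik; rewrite /Z_first.
exact: (@le_bigmax _ _ _ _ (fun i : 'I_k => BR_path Y W i t w) (Ordinal ik)).
Qed.

(** It suffices for the infimum to exceed [c] that the first arrival exceeds
    [c / 2] and the first path does not fall below [c / 2]; these two events are
    independent.  The second may allow equality because the first is strict. *)
Lemma inf_first_tail (c : R) k : (0 < k)%N -> c < 0 ->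
  (P [set w | (inf_first Y W b k w <= c)%R] <= (bound_inf_first b c)%:E)%E.
Proof.
move=> k0 c0.
pose A := [set w | (c / 2 < log_arrival Y 1 w)%R].
pose U := side_exceeds (W 0) b true false (- (c / 2)) `|`
          side_exceeds (W 0) b true true (- (c / 2)).
have c20 : c / 2 < 0 by lra.
have AE : A = [set w | (Y 0 w < expR (- (c / 2)))%R].
  by apply/seteqP; split=> w; rewrite /A/= lt_log_arrival// /block_sum big_ord1.
have AE' : A = Y 0 @^-1` `]-oo, expR (- (c / 2))[.
  by rewrite AE; apply/seteqP; split=> w /=; rewrite in_itv.
have mA : measurable A by rewrite AE'; exact: measurable_funPTI.
have hW := W_brownian hYW 0.
have mU : measurable U.
  by apply: measurableU; exact: measurable_side_exceeds.
apply: (@le_trans _ _ (P (~` (A `&` ~` U)))).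
  apply: le_measure; rewrite ?inE.
  - have := measurable_inf_first k0 measurableT (measurable_itv `]-oo, c]).
    by rewrite setTI.
  - by apply: measurableC; apply: measurableI => //; exact: measurableC.
  (* the infimum is at least the first arrival plus c / 2, hence greater than c *)
  - move=> w /= infc [Aw nU]; move: infc; apply/negP; rewrite -ltNge.
    apply: (@lt_le_trans _ _ (log_arrival Y 1 w + c / 2)).
      by move: Aw; rewrite /A/=; lra.
    apply: lb_le_inf.
      exists (Z_first Y W k b w + `|b| / 2), b => //=.
      by rewrite in_itv/= lexx; have := b0; lra.
    move=> _ [t + <-]; rewrite /= in_itv/= => /andP[tb1 tb2].
    apply: (@le_trans _ _ (BR_path Y W 0 t w + `|t| / 2)); last first.
      by rewrite lerD2r Z_first_ge.
    rewrite /BR_path subrK lerD2l leNgt; apply/negP => Wt; apply: nU.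
    have [t0|t0] := leP 0 t; [left|right].
      exists t; first by rewrite in_itv/= t0.
      by rewrite expr0 expr1 mul1r mulN1r ltrN2.
    exists (- t); first by rewrite in_itv/=; lra.
    by rewrite expr1 mulN1r mulN1r opprK ltrN2.
rewrite probability_setC; last by apply: measurableI => //; exact: measurableC.
have -> : (P (A `&` ~` U) = P A * P (~` U))%E.
  apply: (YW_independent hYW).
  - apply: sub_gen_smallest; exists 0 => //.
    by exists `]-oo, expR (- (c / 2))[%classic; rewrite ?setTI.
  - rewrite /U (two_sides_exceedE hW b0).
    apply: (@measurableC _ (g_sigma_algebraType _)).
    apply: (@measurable_gt _ (g_sigma_algebraType (\bigcup_it
      sigma_rv ((fun (it : nat * R) (w : T) => W it.1 it.2 w) it)))).
    apply: measurable_path_sup => // [t|w].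
      apply: measurable_funM; first exact: measurable_cst.
      by apply: measurable_fun_generate => B WB; exists (0, t).
    exact: (continuous_signed hW).
rewrite AE prob_Y_lt// ?expR_gt0// /bound_inf_first [leRHS]EFinB leeB//.
rewrite [leLHS]EFinM; apply: lee_pmul.
- by rewrite lee_fin subr_ge0 -expR0 ler_expR oppr_le0 expR_ge0.
- by rewrite lee_fin sqr_ge0.
- by [].
rewrite probability_setC//.
have -> : (2 * Phi (- (c / (2 * Num.sqrt b))) - 1) ^+ 2 =
    1 - (1 - (2 * Phi (- (c / 2) / Num.sqrt b) - 1) ^+ 2).
  transitivity ((2 * Phi (- (c / 2) / Num.sqrt b) - 1) ^+ 2); last by ring.
  congr ((2 * Phi _ - 1) ^+ 2).
  by rewrite invfM mulrA mulNr.
rewrite EFinB leeB//; apply: two_sides_exceed => //.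
by rewrite oppr_ge0 ltW.
Qed.

Section later_paths.
Variables (x c : R) (k : nat).
Hypothesis xc : x < c.
Hypothesis c0 : c < 0.
Hypothesis k0 : (0 < k)%N.

Definition good_event : set T :=
  [set w | log_arrival Y k w <= x] `&` [set w | c < inf_first Y W b k w].

Definition brownian_sup (i : nat) (w : T) : R := path_sup b (fun t => W i t w).

(** Path [k + j] has to cause [hit j] if it is to overtake the first [k] paths on
    the good event.  The barrier involves [x] in place of the arrival of index
    [k], so that [hit j] ignores the first [k] paths. *)
Definition hit (j : nat) : set T :=
  [set w | barrier x c (block_sum Y k j.+1 w) < brownian_sup (k + j)%N w].

Let cW i w : continuous (fun t => W i t w).
Proof. exact: (sbm_continuous (W_brownian hYW i)). Qed.

Lemma good_event_generated :
  <<s rectangles Y W [set i | (i < k)%N] >> good_event.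
Proof.
pose G := rectangles Y W [set i | (i < k)%N].
have mY l : (l < k)%N ->
    measurable_fun (setT : set (g_sigma_algebraType G)) (Y l).
  by move=> lk; exact: measurable_Y_rectangles.
apply: (@measurableI _ (g_sigma_algebraType G)).
- have -> : [set w | log_arrival Y k w <= x] =
      log_arrival Y k @^-1` `]-oo, x].
    by apply/seteqP; split=> w /=; rewrite in_itv.
  apply: generate_preimage => //.
  exact: (@measurable_log_inv_sum R _ (g_sigma_algebraType G) (fun i w => Y i w)).
- apply: (@measurable_gt _ (g_sigma_algebraType G)).
  apply: (@measurable_inf_path_max R _ (g_sigma_algebraType G) b b0
    (fun i w => Y i w) (fun i t w => W i t w)) => //.
  by move=> l t lk; exact: measurable_W_rectangles.
Qed.

Lemma hit_generated j : <<s rectangles Y W [set i | (k <= i)%N] >> (hit j).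
Proof.
pose G := rectangles Y W [set i | (k <= i)%N].
have -> : hit j = [set w | 0 < brownian_sup (k + j)%N w -
    barrier x c (block_sum Y k j.+1 w)].
  by apply/seteqP; split=> w /=; rewrite subr_gt0.
apply: (@measurable_gt _ (g_sigma_algebraType G)); apply: measurable_funB.
  apply: measurable_path_sup => // t.
  by apply: measurable_W_rectangles; exact: leq_addr.
apply: measurableT_comp; first exact: measurable_barrier.
apply: measurable_sum => i.
by apply: measurable_Y_rectangles; exact: leq_addr.
Qed.

Lemma rectangles_measurable J : <<s rectangles Y W J >> `<=` measurable.
Proof.
apply: sub_generate_measurable => _ [A [B [YA WB ->]]]; apply: measurableI.
  exact: sigma_block_measurable YA.
exact: path_block_measurable WB.
Qed.

Lemma good_event_measurable : measurable good_event.
Proof. exact: rectangles_measurable good_event_generated. Qed.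

Lemma hit_measurable j : measurable (hit j).
Proof. exact: rectangles_measurable (@hit_generated j). Qed.

(** The good event is about the first [k] variables and paths, [hit j] about the
    later ones. *)
Lemma good_event_indep j : P (good_event `&` hit j) = (P good_event * P (hit j))%E.
Proof.
apply: (independent2_rectangles hYW _ good_event_generated (@hit_generated j)).
by apply/seteqP; split => // i /= [ik]; rewrite leqNgt ik.
Qed.

Lemma measurable_brownian_sup_rv i : measurable_fun setT (brownian_sup i).
Proof. exact: (measurable_brownian_sup (W_brownian hYW i) b0). Qed.

(** The supremum of the path is independent of the sum that sets the barrier, so
    the tail bound can be applied with the barrier held fixed. *)
Lemma prob_hit_le j :
  (P (hit j) <= \int[P]_w (hit_density b x c (block_sum Y k j.+1 w))%:E)%E.
Proof.
pose S w := block_sum Y k j.+1 w.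
pose M w := brownian_sup (k + j)%N w.
have mS : measurable_fun setT S by exact: measurable_block_sum.
have mM : measurable_fun setT M by exact: measurable_brownian_sup_rv.
pose D := [set z : R * R | barrier x c z.1 < z.2].
have mD : measurable D.
  have -> : D = [set z : R * R | 0 < z.2 - barrier x c z.1].
    by apply/seteqP; split => z; rewrite /D/= subr_gt0.
  apply: measurable_gt; apply: measurable_funB => //.
  apply: measurableT_comp => //; exact: measurable_barrier.
have indep A B : measurable A -> measurable B ->
    P (S @^-1` A `&` M @^-1` B) = (P (S @^-1` A) * P (M @^-1` B))%E.
  move=> mA mB; apply: (YW_independent hYW).
  - apply: (@sigma_block_sub _ _ _ _ Y setT).
    by apply: sigma_block_sum.
  - apply: generate_preimage => //; apply: measurable_path_sup => // t.
    by apply: measurable_fun_generate => C WC; exists ((k + j)%N, t).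
have -> : P (hit j) = (\int[P]_w (\1_D (S w, M w))%:E)%E.
  transitivity (\int[P]_w (\1_(hit j) w)%:E)%E => //.
  by rewrite integral_indic ?setIT//; exact: hit_measurable.
have m1D : measurable_fun setT (fun z : R * R => (\1_D z : R)%:E).
  by apply/measurable_EFinP; exact: measurable_indic.
rewrite (independent_fubini mS mM indep m1D)//.
apply: ae_ge0_le_integral => //.
- by move=> w _; apply: integral_ge0 => v _; rewrite lee_fin.
- pose F (z : R * T) : \bar R := (\1_D (z.1, M z.2))%:E.
  have mF : measurable_fun setT F.
    apply: (measurableT_comp m1D); apply/measurable_fun_pair => //.
    exact: measurableT_comp.
  have F0 z : (0 <= F z)%E by rewrite lee_fin.
  exact: (measurableT_comp (measurable_fun_fubini_tonelli_F (m2 := P) _ mF F0) mS).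
- by move=> w _; rewrite lee_fin hit_density_ge0.
- apply/measurable_EFinP; apply: measurableT_comp => //.
  exact: measurable_hit_density.
- apply: filterS (ae_Y_ge0 Yexp) => w Y0 _.
  have S0 : 0 <= S w by exact: block_sum_ge0.
  apply: le_trans
    (_ : ((4 * (1 - Phi (barrier x c (S w) / Num.sqrt b)))%:E <= _)%E); last first.
    by rewrite lee_fin normal_tail_hit_density.
  apply: le_trans (brownian_sup_tail (W_brownian hYW (k + j)%N) b0 _).
  rewrite -[X in P X]setIT -integral_indic//.
  by apply: measurable_gt; exact: mM.
Qed.

Lemma block_sum_cat j w :
  block_sum Y 0 (k + j) w = block_sum Y 0 k w + block_sum Y k j w.
Proof.
by rewrite /block_sum big_split_ord.
Qed.

(** The partial maximum never exceeds the supremum over all paths, so they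
    differ exactly when some path lies strictly above the partial maximum. *)
Lemma Z_errorE : Z_error Y W b k =
  \bigcup_i [set w | exists2 t, t \in `[- b, b] &
     Z_first Y W k t w < BR_path Y W i t w].
Proof.
apply/seteqP; split => w.
  move=> [t tb Zt].
  have Zle : ((Z_first Y W k t w)%:E <= Z_all Y W t w)%E.
    have BZ i : ((BR_path Y W i t w)%:E <= Z_all Y W t w)%E.
      by apply: ereal_sup_ubound; exists i.
    rewrite /Z_first; apply: (big_ind (fun z => z%:E <= Z_all Y W t w)%E) => //.
    by move=> u v hu hv; rewrite /Num.max; case: ifP.
  have : ((Z_first Y W k t w)%:E < Z_all Y W t w)%E.
    by rewrite lt_neqAle Zle andbT; apply/eqP.
  move=> /ereal_sup_gt[_ [i _ <-]]; rewrite lte_fin => h.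
  by exists i => //; exists t.
move=> [i _ [t tb h]]; exists t => // ZE.
have : ((BR_path Y W i t w)%:E <= Z_all Y W t w)%E.
  by apply: ereal_sup_ubound; exists i.
by rewrite -ZE lee_fin leNgt h.
Qed.

Lemma Z_error_measurable : measurable (Z_error Y W b k).
Proof.
rewrite Z_errorE; apply: bigcup_measurable => i _.
exact: (@measurable_path_overtakes R _ T b b0 (fun i w => Y i w)
  (fun i t w => W i t w)).
Qed.

(** An overtaking path has an index [i >= k], and at the time of overtaking its
    value plus [`|t| / 2] exceeds [c].  The good event gives
    [S_k >= expR (- x)], so the starting point is at most
    [- ln (expR (- x) + S')], with [S'] the sum of the variables of index
    [k, ..., i].  The exceptional set is where some variable is negative. *)
Lemma Z_error_hit : {ae P, forall w,
  (Z_error Y W b k `&` good_event) w -> (\bigcup_j (good_event `&` hit j)) w}.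
Proof.
apply: filterS (ae_Y_ge0 Yexp) => w Y0 [].
rewrite Z_errorE => -[i _ [t tb Zt]] Ew.
have [ik|ki] := ltnP i k.
  by have := Z_first_ge t w ik; rewrite leNgt Zt.
exists (i - k)%N => //; split => //.
rewrite /hit/= subnKC//.
case: Ew => /= Xx Cc.
have Zc : c < Z_first Y W k t w + `|t| / 2.
  apply: (lt_le_trans Cc); apply: ge_inf; last by exists t.
  have cZ : continuous (fun t => - (Z_first Y W k t w + `|t| / 2)).
    move=> u; apply: cvgN; apply: cvgD.
      exact: (@continuous_path_max R _ T (fun i w => Y i w) (fun i t w => W i t w) cW).
    by apply: cvgM; [exact: norm_continuous|exact: cvg_cst].
  exists (- path_sup b (fun t => - (Z_first Y W k t w + `|t| / 2))).
  move=> _ [u ub <-]; rewrite lerNl.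
  exact: (path_sup_ge b0 cZ ub).
have S0 : expR (- x) <= block_sum Y 0 k w.
  by rewrite leNgt -(lt_log_arrival _ _ (lt_trans xc c0)) -leNgt.
have S'0 : 0 <= block_sum Y k (i - k).+1 w by exact: block_sum_ge0.
have e0 := expR_gt0 (- x).
have XE : log_arrival Y i.+1 w =
    - ln (block_sum Y 0 k w + block_sum Y k (i - k).+1 w).
  rewrite /log_arrival ln_div1 -/(block_sum Y 0 i.+1 w).
  by rewrite -block_sum_cat addnS subnKC.
have h : ln (expR (- x) + block_sum Y k (i - k).+1 w) <=
    ln (block_sum Y 0 k w + block_sum Y k (i - k).+1 w).
  by rewrite ler_ln ?posrE ?lerD2r//; lra.
apply: lt_le_trans (path_sup_ge b0 (@cW i w) tb).
move: Zt; rewrite /BR_path XE /barrier; lra.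
Qed.

Lemma error_good_event :
  (P (Z_error Y W b k `&` good_event)
    <= P good_event * (bound_cond_error b x c)%:E)%E.
Proof.
have mE := good_event_measurable.
have mEH j : measurable (good_event `&` hit j).
  by apply: measurableI => //; exact: hit_measurable.
apply: (@le_trans _ _ (P (\bigcup_j (good_event `&` hit j)))).
  apply: le_measure_ae.
  - by apply: measurableI => //; exact: Z_error_measurable.
  - exact: bigcupT_measurable.
  - exact: Z_error_hit.
apply: (@le_trans _ _ (\sum_(0 <= j <oo) P (good_event `&` hit j))%E).
  by apply: generalized_Boole_inequality => //; exact: bigcupT_measurable.
apply: lime_le; first by apply: is_cvg_nneseries.
apply: nearW => n.
under eq_bigr do rewrite good_event_indep.
rewrite -ge0_sume_distrr//; apply: lee_wpmul2l => //.
rewrite big_mkord.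
apply: le_trans (sum_hit_density_le b0 xc Yexp Yind k n).
by apply: lee_sum => j _; exact: prob_hit_le.
Qed.

End later_paths.

End main.

Theorem proposition3p8 (R : realType) (d : measure_display)
    (T : measurableType d) (P : probability T R)
    (Y : nat -> {RV P >-> R}) (W : nat -> R -> {RV P >-> R})
    (hYW : brown_resnick_input Y W)
    (b : R) (hb : 0 < b) (k : nat) (hk : (0 < k)%N)
    (x c : R) (hxc : x < c) (hc : c < 0) :
  [/\ cond_prob P (Z_error Y W b k)
        ([set w | log_arrival Y k w <= x] `&` [set w | c < inf_first Y W b k w])
        <= bound_cond_error b x c,
      (P [set w | (inf_first Y W b k w <= c)%R] <= (bound_inf_first b c)%:E)%E,
      (P [set w | (x < log_arrival Y k w)%R] <= (bound_log_arrival k x)%:E)%E &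
      (P (Z_error Y W b k) <=
         (bound_cond_error b x c + bound_inf_first b c + bound_log_arrival k x)%:E)%E].
Proof.
have x0 : x < 0 by exact: lt_trans hc.
have h1 := error_good_event hYW hb hxc hc hk.
have h2 := inf_first_tail hYW hb hk hc.
have h3 := log_arrival_tail hYW hk x0.
have B0 : 0 <= bound_cond_error b x c.
  by rewrite -hit_potential0 hit_potential_ge0.
set E := good_event Y W b x c k in h1 *.
have mE : measurable E by exact: (good_event_measurable hYW).
have mZ : measurable (Z_error Y W b k) by exact: (Z_error_measurable hYW).
have mC : measurable [set w | (inf_first Y W b k w <= c)%R].
  have := measurable_inf_first hYW hb hk measurableT (measurable_itv `]-oo, c]).
  by rewrite setTI.
have mX : measurable [set w | (x < log_arrival Y k w)%R].
  apply: measurable_gt.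
  exact: (@measurable_log_inv_sum R _ T (fun i w => Y i w)).
split => //.
- rewrite /cond_prob -/(good_event Y W b x c k) -/E.
  have [PE0|PE0] := eqVneq (fine (P E)) 0; first by rewrite PE0 invr0 mulr0.
  have PEp : 0 < fine (P E) by rewrite lt_neqAle eq_sym PE0 fine_ge0.
  rewrite ler_pdivrMr// mulrC -lee_fin EFinM !fineK ?fin_num_measure//.
  exact: measurableI.
- rewrite !EFinD.
  apply: (@le_trans _ _ (P (((Z_error Y W b k `&` E) `|`
    [set w | (inf_first Y W b k w <= c)%R]) `|` [set w | (x < log_arrival Y k w)%R]))).
    apply: le_measure; rewrite ?inE//.
      by apply: measurableU => //; apply: measurableU => //; exact: measurableI.
    move=> w Zw; have [Xx|xX] := leP (log_arrival Y k w) x; last by right.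
    have [cC|Cc] := ltP c (inf_first Y W b k w); last by left; right.
    by left; left.
  have mZE : measurable (Z_error Y W b k `&` E) by exact: measurableI.
  apply: (le_trans (measureU2 _ (measurableU _ _ mZE mC) mX)).
  apply: leeD => //.
  apply: (le_trans (measureU2 _ mZE mC)); apply: leeD => //.
  apply: (le_trans h1); rewrite -[leRHS]mul1e; apply: lee_wpmul2r.
    by rewrite lee_fin.
  exact: probability_le1.
Qed.
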